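(* Let $a,b$ be real with $a>-1$, $b>-1$, $a+b\ge-1$, and put $\varepsilon=\frac{a+b+1}{2}$. Let $N>K\ge1$ be integers, $L=N-K+1$, and let $\nu\in\mathrm{Sign}^+_N$. Then, as an identity of rational functions in $t_1,\dots,t_K$, $$ \prod_{j=1}^K F_N(t_j;\nu;\varepsilon)=\sum_{\varkappa\in\mathrm{Sign}^+_K}\frac{\Lambda^N_K(\nu,\varkappa)}{d_K(\varkappa;\varepsilon)}\,G_{\varkappa,K}(t_1,\dots,t_K). $$ The sum on the right-hand side is finite (only finitely many $\Lambda^N_K(\nu,\varkappa)$ are nonzero), and the quantities $\Lambda^N_K(\nu,\varkappa)$ are uniquely determined by this formula: if a finitely supported family $(c_\varkappa)_{\varkappa\in\mathrm{Sign}^+_K}$ satisfies the identity with $c_\varkappa$ in place of $\Lambda^N_K(\nu,\varkappa)$, then $c_\varkappa=\Lambda^N_K(\nu,\varkappa)$ for all $\varkappa$.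
   Context: $\mathrm{Sign}^+_N$ is the set of $N$-tuples of integers $\nu_1\ge\dots\ge\nu_N\ge0$. Jacobi polynomials: $P^{(a,b)}_n(x)$ is the classical Jacobi polynomial of degree $n$, orthogonal with weight $(1-x)^a(1+x)^b$ on $[-1,1]$. For $\nu\in\mathrm{Sign}^+_N$, $$P^{(a,b)}_{\nu,N}(x_1,\dots,x_N)=\frac{\det[P^{(a,b)}_{\nu_i+N-i}(x_j)]_{i,j=1}^N}{\prod_{1\le i<j\le N}(x_i-x_j)},\qquad \widetilde P^{(a,b)}_{\nu,N}(x_1,\dots,x_N)=\frac{P^{(a,b)}_{\nu,N}(x_1,\dots,x_N)}{P^{(a,b)}_{\nu,N}(1,\dots,1)}.$$ The coefficients $\Lambda^N_K(\nu,\varkappa)$ (depending also on $(a,b)$) are defined by the expansion $$\widetilde P^{(a,b)}_{\nu,N}(x_1,\dots,x_K,1,\dots,1)=\sum_{\varkappa\in\mathrm{Sign}^+_K}\Lambda^N_K(\nu,\varkappa)\,\widetilde P^{(a,b)}_{\varkappa,K}(x_1,\dots,x_K).$$ Further notation: $$F_N(t;\nu;\varepsilon)=\prod_{i=1}^N\frac{t^2-(N-i+\varepsilon)^2}{t^2-(\nu_i+N-i+\varepsilon)^2},$$ $$d_K(\varkappa;\varepsilon)=\prod_{1\le i<j\le K}\frac{(\varkappa_i+K-i+\varepsilon)^2-(\varkappa_j+K-j+\varepsilon)^2}{(K-i+\varepsilon)^2-(K-j+\varepsilon)^2},$$ $$g_k(t)={}_4F_3\left[\begin{matrix}-k,\ k+2\varepsilon,\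 L,\ L+a\\ -t+L+\varepsilon,\ t+L+\varepsilon,\ a+1\end{matrix}\,\Big|\,1\right],\quad k=0,1,2,\dots$$ (a terminating hypergeometric series, hence a rational function of $t$), and $$G_{\varkappa,K}(t_1,\dots,t_K)=\frac{\det[g_{\varkappa_i+K-i}(t_j)]_{i,j=1}^K}{\det[g_{K-i}(t_j)]_{i,j=1}^K},\qquad \varkappa\in\mathrm{Sign}^+_K.$$ *)

(* Defs.v *)
From mathcomp Require Import all_boot all_order all_algebra.
From mathcomp Require Import fraction.
From mathcomp Require Import boolp classical_sets functions cardinality fsbigop.
From mathcomp.multinomials Require Import mpoly.

Set Implicit Arguments.
Unset Strict Implicit.
Unset Printing Implicit Defensive.

Import GRing.Theory.

Local Open Scope classical_set_scope.
Local Open Scope ring_scope.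

Definition signature (N : nat) := {nu : N.-tuple nat | sorted geq nu}.

(* Parts are indexed by ['I_N], i.e. from 0: [nu i] is the (i+1)-st part. *)
Definition part N (nu : signature N) (i : 'I_N) : nat := tnth (val nu) i.

Coercion part : signature >-> Funclass.

(* nu_i + N - i for the 1-based index i. *)
Definition shifted N (nu : signature N) (i : 'I_N) : nat := (nu i + (N - i.+1))%N.

Definition poch (F : fieldType) (x : F) (m : nat) : F :=
  \prod_(i < m) (x + i%:R).

(* The coefficient of z^m in pFq[num; den | z]. *)
Definition hyp_coef (F : fieldType) (num den : seq F) (m : nat) : F :=
  (\prod_(u <- num) poch u m) / ((\prod_(v <- den) poch v m) * (m`!)%:R).

(* P_n^(a,b)(x) = (a+1)_n / n! * 2F1[-n, n+a+b+1; a+1 | (1-x)/2], the classical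
   explicit form, with the usual normalization P_n^(a,b)(1) = (a+1)_n / n!. *)
Definition jacobi (F : fieldType) (a b : F) (n : nat) : {poly F} :=
  (poch (a + 1) n / (n`!)%:R) *:
  \sum_(m < n.+1)
    hyp_coef [:: - n%:R; n%:R + a + b + 1] [:: a + 1] m
    *: (2^-1 *: (1 - 'X)) ^+ m.

Definition vandermonde_prod (F : fieldType) (N : nat) : {mpoly F[N]} :=
  \prod_(i < N) \prod_(j < N | (i < j)%N) ('X_i - 'X_j).

Definition jacobi_det (F : fieldType) (a b : F) N (nu : signature N) :
    {mpoly F[N]} :=
  \det (\matrix_(i < N, j < N)
          (map_poly (@mpolyC N F) (jacobi a b (shifted nu i))).['X_j]).

(* The quotient of [jacobi_det] by [vandermonde_prod] taken among polynomials, so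
   that it can be evaluated where the Vandermonde product vanishes. It exists by
   [jacobi_mvE] below and is unique because {mpoly F[N]} is a domain. *)
Definition jacobi_mv (F : fieldType) (a b : F) N (nu : signature N) :
    {mpoly F[N]} :=
  xget 0 [set p | p * vandermonde_prod F N = jacobi_det a b nu].

Section QuotientExists.
Variables (F : fieldType) (N : nat).
Implicit Types (p q : {mpoly F[N]}) (u v : 'I_N * 'I_N).

Let merge u : N.-tuple {mpoly F[N]} :=
  [tuple 'X_(if k == u.1 then u.2 else k) | k < N].

Let mergeX u k : 'X_k \mPo merge u = 'X_(if k == u.1 then u.2 else k).
Proof. by rewrite comp_mpolyXU -tnth_nth tnth_mktuple. Qed.

Let mpolyX_inj (i j : 'I_N) : 'X_i = 'X_j :> {mpoly F[N]} -> i = j.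
Proof.
move=> /(congr1 (meval (fun k => (k == i)%:R))); rewrite !mevalXU eqxx.
by case: eqVneq => // _ /eqP; rewrite oner_eq0.
Qed.

Let merge_dvd u p :
  exists q, p - (p \mPo merge u) = q * ('X_u.1 - 'X_u.2).
Proof.
pose D p := exists q, p - (p \mPo merge u) = q * ('X_u.1 - 'X_u.2).
have DC c : D c%:MP by exists 0; rewrite comp_mpolyC subrr mul0r.
have DD p1 p2 : D p1 -> D p2 -> D (p1 + p2).
  move=> [q1 e1] [q2 e2]; exists (q1 + q2).
  by rewrite mulrDl -e1 -e2 rmorphD /= opprD addrACA.
have DM p1 p2 : D p1 -> D p2 -> D (p1 * p2).
  move=> [q1 e1] [q2 e2]; exists (q1 * p2 + (p1 \mPo merge u) * q2).
  by rewrite mulrDl mulrAC -e1 -mulrA -e2 rmorphM /= mulrBl mulrBr addrA subrK.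
have DX k : D 'X_k.
  rewrite /D mergeX; case: eqP => [->|_]; first by exists 1; rewrite mul1r.
  by exists 0; rewrite subrr mul0r.
rewrite -/(D p) (mpolyE p); apply: (big_ind D) => [||m _].
- exact: DC.
- exact: DD.
rewrite -mul_mpolyC; apply: (DM _ _ (DC _)); rewrite mpolyXE_id.
apply: (big_ind D) => [||k _]; [exact: DC | exact: DM |].
by elim: (m k) => [|d IH]; [exact: DC | rewrite exprS; exact: DM].
Qed.

Let vandermonde_dvd p :
    (forall u, (u.1 < u.2)%N -> p \mPo merge u = 0) ->
  exists q, q * vandermonde_prod F N = p.
Proof.
move=> p0; rewrite /vandermonde_prod pair_big_dep /= -big_filter.
set s := filter _ _.
have : uniq s by rewrite filter_uniq // index_enum_uniq.
have : all (fun u => (u.1 < u.2)%N) s by apply: filter_all.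
elim: s => [|u s IHs] /=; first by exists p; rewrite big_nil mulr1.
move=> /andP[lt_u lt_s] /andP[us /(IHs lt_s)[q def_p]].
have: (q \mPo merge u) *
    \prod_(v <- s) (('X_v.1 - 'X_v.2) \mPo merge u) = 0.
  by rewrite -(rmorph_prod (comp_mpoly (merge u))) -rmorphM /= def_p p0.
move=> /eqP; rewrite mulf_eq0 => /orP[/eqP q0|]; last first.
  rewrite prodf_seq_eq0 => /hasP[v vs /= v0]; exfalso; move: vs v0.
  rewrite comp_mpolyB !mergeX subr_eq0 => vs /eqP/mpolyX_inj.
  have := allP lt_s v vs; move: us vs lt_u; case: u v => [i j] [k l] /=.
  case: (eqVneq k i) => [->|ki]; case: (eqVneq l i) => [->|li].
  - by rewrite ltnn.
  - by move=> us vs _ _ e; rewrite e vs in us.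
  - by move=> _ _ ij ki' e; move: ij; rewrite -e ltnNge ltnW.
  - by move=> _ _ _ kl e; move: kl; rewrite e ltnn.
have [q'] := merge_dvd u q; rewrite q0 subr0 => def_q.
by exists q'; rewrite big_cons mulrA -def_q.
Qed.

Lemma jacobi_mvE (a b : F) (nu : signature N) :
  jacobi_mv a b nu * vandermonde_prod F N = jacobi_det a b nu.
Proof.
suff /vandermonde_dvd[q def_q] :
    forall u, (u.1 < u.2)%N -> jacobi_det a b nu \mPo merge u = 0.
  exact: (@xgetI _ 0 [set p | p * vandermonde_prod F N = jacobi_det a b nu] q).
move=> u lt_u.
have neq_u : u.1 != u.2 by apply: contraTneq lt_u => ->; rewrite ltnn.
rewrite /jacobi_det -det_map_mx -det_tr.
apply: (determinant_alternate neq_u) => i; rewrite !mxE.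
rewrite -!(horner_map (comp_mpoly (merge u))) /= !mergeX eqxx.
by rewrite [u.2 == _]eq_sym (negbTE neq_u).
Qed.

End QuotientExists.

Definition jacobi_norm (F : fieldType) (a b : F) N (nu : signature N) :
    {mpoly F[N]} :=
  ((jacobi_mv a b nu).@[fun=> 1])^-1 *: jacobi_mv a b nu.

(* (x_1, ..., x_K, 1, ..., 1) *)
Definition pad_ones (F : fieldType) (N K : nat) : N.-tuple {mpoly F[K]} :=
  [tuple if insub (val i) is Some k then 'X_(k : 'I_K) else 1 | i < N].

Definition finitely_supported (F : fieldType) K (c : signature K -> F) : Prop :=
  finite_set [set kappa | c kappa != 0].

(* The sum is [fsbigop]'s sum over a possibly infinite index set, which is 0 by
   convention when the support is infinite: finite support is thus required. *)
Definition branching (F : fieldType) (a b : F) N K (nu : signature N)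
    (c : signature K -> F) : Prop :=
  finitely_supported c /\
  jacobi_norm a b nu \mPo pad_ones F N K =
    \sum_(kappa \in [set: signature K]) c kappa *: jacobi_norm a b kappa.

(* For real a, b > -1 and K <= N the normalized Jacobi polynomials are a basis of
   the symmetric polynomials, so exactly one family satisfies [branching]; the
   zero family is only a default value. *)
Definition Lambda (F : fieldType) (a b : F) N K (nu : signature N) :
    signature K -> F :=
  xget (fun=> 0) [set c : signature K -> F | branching a b nu c].

Definition F_prod (F : fieldType) N (t : F) (nu : signature N) (eps : F) : F :=
  \prod_(i < N)
    ((t ^+ 2 - ((N - i.+1)%:R + eps) ^+ 2) /
     (t ^+ 2 - ((shifted nu i)%:R + eps) ^+ 2)).

Definition d_prod (F : fieldType) K (kappa : signature K) (eps : F) : F :=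
  \prod_(i < K) \prod_(j < K | (i < j)%N)
    ((((shifted kappa i)%:R + eps) ^+ 2 - ((shifted kappa j)%:R + eps) ^+ 2) /
     (((K - i.+1)%:R + eps) ^+ 2 - ((K - j.+1)%:R + eps) ^+ 2)).

(* The 4F3 at unit argument, terminated at m = k by the factor (-k)_m. *)
Definition g_fun (F : fieldType) (a eps : F) (L k : nat) (t : F) : F :=
  \sum_(m < k.+1)
    hyp_coef [:: - k%:R; k%:R + eps *+ 2; L%:R; L%:R + a]
             [:: - t + L%:R + eps; t + L%:R + eps; a + 1] m.

Definition G_fun (F : fieldType) (a eps : F) (L K : nat) (kappa : signature K)
    (t : 'I_K -> F) : F :=
  \det (\matrix_(i < K, j < K) g_fun a eps L (shifted kappa i) (t j)) /
  \det (\matrix_(i < K, j < K) g_fun a eps L (K - i.+1) (t j)).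

Definition ratfun (F : fieldType) (K : nat) : fieldType :=
  {fraction {mpoly F[K]}}.

Definition rat_const (F : fieldType) (K : nat) (c : F) : ratfun F K :=
  tofrac (c%:MP_[K]).

Definition rat_var (F : fieldType) (K : nat) (j : 'I_K) : ratfun F K :=
  tofrac ('X_j : {mpoly F[K]}).

(* The family c plays the role of Lambda^N_K(nu, .). *)
Definition ratfun_identity (F : fieldType) (a eps : F) N K (L : nat)
    (nu : signature N) (c : signature K -> F) : Prop :=
  \prod_(j < K) F_prod (rat_var F j) nu (rat_const K eps) =
  \sum_(kappa \in [set: signature K])
    rat_const K (c kappa / d_prod kappa eps) *
    G_fun (rat_const K a) (rat_const K eps) L kappa (@rat_var F K).

(* Main.v *)
(* Put y = (1 - x) / 2, l_n = (n + eps)^2 and let A_m(s) be the product of the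
   s - l_i over i < m. Up to a factor P_n is sum_m A_m(l_n) w_m y^m with w_m
   independent of n, and g_n is the image of this polynomial under a linear map
   y^m |-> phi_m(t) that does not depend on n either. Apply this map in each of
   the K variables to the branching expansion multiplied by the Vandermonde
   product. On the right-hand side the determinants of the P_n become
   determinants of the g_n. On the left-hand side, letting N - K variables tend
   to y = 0 turns det [P_(n_i)(y_j)] into a confluent determinant, and since
   w_(m+M) phi_m = w_M A_(M+1)(t^2) / A_(m+M+1)(t^2) with M = N - K, the
   telescoping sum of the A_m(l) / A_(m+1)(u) makes its image a
   Cauchy-Vandermonde determinant, equal to E(t) V(l) / prod (t_j^2 - l_(n_i))
   with E independent of nu. Comparing with nu = 0 gives the product of the F_N.
   Uniqueness holds because the g_n are linearly independent. *)

From HB Require Import structures.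
Require Import Defs.
From mathcomp Require Import all_boot all_order all_fingroup all_algebra fraction.
From mathcomp Require Import boolp classical_sets functions cardinality fsbigop.
From mathcomp.multinomials Require Import ssrcomplements mpoly.
From mathcomp Require Import reals ring zify.

Set Implicit Arguments.
Unset Strict Implicit.
Unset Printing Implicit Defensive.

Import Order.TTheory GRing.Theory Num.Theory.

Local Open Scope ring_scope.

(** * Confluent determinants *)

Section Substitution.
Variable F : fieldType.

Definition psubst n (q : {poly F}) (x : {mpoly F[n]}) : {mpoly F[n]} :=
  (map_poly (@mpolyC n F) q).[x].

Lemma psubst_comp n m (q : {poly F}) (x : {mpoly F[n]})
    (t : n.-tuple {mpoly F[m]}) :
  psubst q x \mPo t = psubst q (x \mPo t).
Proof.
rewrite /psubst -horner_map /= -map_poly_comp /=; congr (_.[_]).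
by apply: eq_map_poly => c /=; rewrite comp_mpolyC.
Qed.

Lemma psubstE n (q : {poly F}) (x : {mpoly F[n]}) d : (size q <= d)%N ->
  psubst q x = \sum_(m < d) q`_m *: x ^+ m.
Proof.
move=> qd; rewrite /psubst (@horner_coef_wide _ d); last first.
  by rewrite (leq_trans (size_poly _ _)).
by apply: eq_bigr => m _; rewrite coef_map /= mul_mpolyC.
Qed.

Lemma comp_mpolyA n m k (p : {mpoly F[n]}) (t : n.-tuple {mpoly F[m]})
    (s : m.-tuple {mpoly F[k]}) :
  (p \mPo t) \mPo s = p \mPo [tuple tnth t i \mPo s | i < n].
Proof.
rewrite (comp_mpolyEX p t) (comp_mpolyEX p) rmorph_sum /=.
apply: eq_bigr => m' _; rewrite comp_mpolyZ !comp_mpolyX rmorph_prod /=.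
by congr (_ *: _); apply: eq_bigr => i _; rewrite rmorphXn /= tnth_mktuple.
Qed.

Lemma comp_mpolyXt n m (i : 'I_n) (t : n.-tuple {mpoly F[m]}) :
  'X_i \mPo t = tnth t i.
Proof. by rewrite comp_mpolyXU -tnth_nth. Qed.

Lemma mpolyX_inj n (i j : 'I_n) : 'X_i = 'X_j :> {mpoly F[n]} -> i = j.
Proof.
move=> /(congr1 (meval (fun k => (k == i)%:R))); rewrite !mevalXU eqxx.
by case: eqVneq => // _ /eqP; rewrite oner_eq0.
Qed.

Lemma mpolyX_neq0 n (i : 'I_n) : 'X_i != 0 :> {mpoly F[n]}.
Proof. by rewrite -msize_poly_eq0 msizeX. Qed.

Lemma vandermonde_prod_neq0 n : vandermonde_prod F n != 0.
Proof.
apply/prodf_neq0 => i _; apply/prodf_neq0 => j ij.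
by rewrite subr_eq0; apply: contraTneq ij => /mpolyX_inj ->; rewrite ltnn.
Qed.

Lemma drop_polySE r (q : {poly F}) :
  drop_poly r q = (q`_r)%:P + drop_poly r.+1 q * 'X.
Proof.
by apply/polyP => -[|k]; rewrite coefD coefC coefMX !coef_drop_poly ?addr0 ?add0r
  ?addnS ?addSn.
Qed.

Definition zero_tail n r : n.-tuple {mpoly F[n]} :=
  [tuple if (j < n - r)%N then 'X_j else 0 | j < n].

(* Setting one more variable to 0 in the identity for [r] is, by the triangular
   column operation [U], the identity for [r.+1] times the product of the
   remaining variables, which can be cancelled as long as these are generic. *)
Lemma confluent_det n (q : 'I_n -> {poly F}) (Q : {mpoly F[n]}) r :
    Q * vandermonde_prod F n = \det (\matrix_(i, j) psubst (q i) 'X_j) ->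
    (r <= n)%N ->
  (Q \mPo zero_tail n r) *
    \prod_(i < n) \prod_(j < n | (i < j < n - r)%N) ('X_i - 'X_j) =
  \det (\matrix_(i, j) if (j < n - r)%N then psubst (drop_poly r (q i)) 'X_j
                       else ((q i)`_(n - j.+1))%:MP).
Proof.
move=> defQ; elim: r => [|r IHr] rn.
  transitivity (Q * vandermonde_prod F n).
    congr (_ * _).
      rewrite -[RHS]comp_mpoly_id; congr (_ \mPo _); apply: eq_from_tnth => j.
      by rewrite !tnth_mktuple subn0 ltn_ord.
    apply: eq_bigr => i _; apply: eq_bigl => j.
    by rewrite subn0 ltn_ord andbT.
  rewrite defQ; congr (\det _); apply/matrixP => i j.
  by rewrite !mxE subn0 ltn_ord drop_poly0l.
have {IHr} := IHr (ltnW rn).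
have kn : (n - r.+1 < n)%N by rewrite ltn_subrL /= (leq_trans _ rn).
have nrE : (n - r)%N = (n - r.+1).+1 by rewrite subnSK.
pose k := Ordinal kn.
move=> /(congr1 (comp_mpoly (zero_tail n r.+1))).
rewrite rmorphM /= comp_mpolyA.
have -> : [tuple tnth (zero_tail n r) i \mPo zero_tail n r.+1 | i < n]
          = zero_tail n r.+1.
  apply: eq_from_tnth => j; rewrite !tnth_mktuple nrE ltnS.
  have [jk|/ltnW kj] := leqP j (n - r.+1); first by rewrite comp_mpolyXt tnth_mktuple.
  by rewrite comp_mpoly0 ltnNge kj.
pose U : 'M[{mpoly F[n]}]_n := \matrix_(i, j)
  if i == j then (if (j < k)%N then 'X_j else 1)
  else if (i == k) && (j < k)%N then 1 else 0.
have detU : \det U = \prod_(j < n | (j < k)%N) 'X_j.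
  rewrite det_trig; last first.
    apply/is_trig_mxP => i j ij; rewrite mxE ifN; last first.
      by apply: contraTneq ij => ->; rewrite ltnn.
    case: eqP => //= ik; case: ltnP => // jk.
    by move: ij; rewrite ik ltnNge ltnW.
  by rewrite [RHS]big_mkcond; apply: eq_bigr => i _; rewrite mxE eqxx.
rewrite -det_map_mx; set B := map_mx _ _.
set C := \matrix_(i, j) _.
(* Column [k] of [C] consists of the coefficients of index [n - k.+1 = r]. So [drop_polySE] says
   that, for [j < k], column [j] of [B] is ['X_j] times column [j] of [C] plus column [k] of [C]. *)
have -> : B = C *m U.
  apply/matrixP => i j; rewrite !mxE.
  rewrite (bigD1 j) //= !mxE eqxx nrE ltnS.
  have [jk|kj] := ltnP j k.
    rewrite (bigD1 k) /=; last by rewrite eq_sym neq_ltn jk.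
    rewrite !mxE eqxx ?jk /= ltnn (_ : k == j = false); last first.
      by apply/negbTE; rewrite eq_sym neq_ltn jk.
    rewrite big1 => [|l /andP[lj lk]]; last first.
      by rewrite !mxE (negbTE lj) (negbTE lk) mulr0.
    rewrite ?(ltnW jk) ?jk psubst_comp comp_mpolyXt tnth_mktuple ?jk.
    rewrite drop_polySE /psubst rmorphD rmorphM /= map_polyC map_polyX /=.
    rewrite hornerD hornerC hornerMX addr0 mulr1 addrC. congr (_%:MP + _).
    by congr (_ `_ _); rewrite subnSK // subKn // ltnW.
  rewrite big1 ?addr0 ?mulr1 => [|l lj]; last first.
    by rewrite !mxE (negbTE lj) (leq_gtF kj) andbF mulr0.
  have [kj'|jk] := ltnP k j; first by rewrite ?(ltn_geF kj') ?(leq_gtF kj) comp_mpolyC.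
  have /eqP jE: (j == k :> nat) by rewrite eqn_leq jk.
  rewrite ?jk ?(leq_gtF kj) psubst_comp comp_mpolyXt tnth_mktuple (leq_gtF kj) /=.
  rewrite drop_polySE /psubst rmorphD rmorphM /= map_polyC map_polyX /=.
  rewrite hornerD hornerC hornerMX mulr0 addr0; congr (_%:MP).
  by congr (_ `_ _); rewrite jE /= subnSK // subKn // ltnW.
rewrite det_mulmx detU => eqQ.
have X0 : \prod_(j < n | (j < k)%N) 'X_j != 0 :> {mpoly F[n]}.
  by apply/prodf_neq0 => j _; apply: mpolyX_neq0.
apply: (mulIf X0); rewrite -{}eqQ -mulrA; congr (_ * _).
(* Under the substitution the factors ['X_i - 'X_k] with [i < k] become ['X_i]: together they are
   [\det U]. *)
rewrite [X in _ * X = _]big_mkcond -big_split rmorph_prod /=.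
apply: eq_bigr => i _; rewrite rmorph_prod /= nrE.
have [ik|ki] := ltnP i k; last first.
  rewrite mulr1 !big1 // => j /andP[ij].
    by rewrite ltnS leqNgt (leq_ltn_trans ki ij).
  by rewrite ltnNge ltnW // (leq_ltn_trans ki ij).
rewrite [RHS](bigD1 k) /=; last by rewrite ik ltnS leqnn.
rewrite rmorphB /= !comp_mpolyXt !tnth_mktuple ltnn ik subr0 mulrC.
congr (_ * _); apply: eq_big => j.
  by rewrite ltnS [(j <= _)%N]leq_eqVlt -val_eqE /=; case: eqVneq => [->|];
    rewrite ?ltnn ?andbF ?andbT.
by move=> /andP[_ jk]; rewrite rmorphB /= !comp_mpolyXt !tnth_mktuple ik jk.
Qed.

End Substitution.

(** * Linear substitutions of monomials *)

Section Umbral.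
Variables (F : fieldType) (S : comNzRingType) (iota : {rmorphism F -> S}).

(* The linear maps sending 'X^m to [h m], resp. 'X_[m] to the product of the
   [h j (m j)]. *)
Definition umbral (h : nat -> S) (q : {poly F}) : S :=
  \sum_(m < size q) iota q`_m * h m.

Definition mumbral n (h : 'I_n -> nat -> S) (p : {mpoly F[n]}) : S :=
  \sum_(m <- msupp p) iota p@_m * \prod_j h j (m j).

Lemma umbralE d h (q : {poly F}) : (size q <= d)%N ->
  umbral h q = \sum_(m < d) iota q`_m * h m.
Proof.
move=> qd; rewrite /umbral !(big_ord_widen d (fun m => iota q`_m * h m) qd).
rewrite big_mkcond; apply: eq_bigr => m _.
by case: ltnP => // qm; rewrite nth_default // rmorph0 mul0r.
Qed.

Section Multivariate.
Variables (n : nat) (h : 'I_n -> nat -> S).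

Lemma mumbralE k (p : {mpoly F[n]}) : (msize p <= k)%N ->
  mumbral h p = \sum_(m : 'X_{1..n < k}) iota p@_m * \prod_j h j (m j).
Proof.
move=> pk; rewrite /mumbral (big_mksub 'X_{1..n < k}) ?msupp_uniq //=; last first.
  by move=> x /msize_mdeg_lt /leq_trans; apply.
rewrite big_rmcond //= => j /memN_msupp_eq0 ->.
by rewrite rmorph0 mul0r.
Qed.

Lemma mumbral_is_zmod_morphism : zmod_morphism (mumbral h).
Proof.
move=> p q; set k := maxn (msize (p - q)) (maxn (msize p) (msize q)).
rewrite !(@mumbralE k) ?leq_max ?leqnn ?orbT // -sumrB.
by apply: eq_bigr => m _; rewrite mcoeffB rmorphB mulrBl.
Qed.

HB.instance Definition _ := GRing.isZmodMorphism.Build {mpoly F[n]} S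
  (mumbral h) mumbral_is_zmod_morphism.

Lemma mumbralZ c p : mumbral h (c *: p) = iota c * mumbral h p.
Proof.
set k := maxn (msize (c *: p)) (msize p).
rewrite !(@mumbralE k) ?leq_max ?leqnn ?orbT // mulr_sumr.
by apply: eq_bigr => m _; rewrite mcoeffZ rmorphM mulrA.
Qed.

Lemma mumbralX m : mumbral h 'X_[m] = \prod_j h j (m j).
Proof. by rewrite /mumbral msuppX big_seq1 mcoeffX eqxx rmorph1 mul1r. Qed.

(** [mumbral h] is linear but not multiplicative; it does respect products whose factors involve
    distinct variables, because it maps a monomial to a product over the variables. *)
Lemma mumbral_prod (q : 'I_n -> {poly F}) :
  mumbral h (\prod_j psubst (q j) 'X_j) = \prod_j umbral (h j) (q j).
Proof.
set d := \max_j size (q j).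
have qd j : (size (q j) <= d)%N by apply: leq_bigmax.
under eq_bigr do rewrite (psubstE _ (qd _)).
under [RHS]eq_bigr do rewrite (umbralE _ (qd _)).
rewrite !bigA_distr_bigA raddf_sum; apply: eq_bigr => f _ /=.
rewrite scaler_prod mumbralZ rmorph_prod big_split /=; congr (_ * _).
transitivity (mumbral h 'X_[[multinom (f j : nat) | j < n]]).
  by rewrite mpolyXE_id; congr mumbral; apply: eq_bigr => j _; rewrite mnmE.
by rewrite mumbralX; apply: eq_bigr => j _; rewrite mnmE.
Qed.

(** After transposition, each term of the Leibniz expansion has exactly one factor for each
    variable, so [mumbral_prod] applies to it. *)
Lemma mumbral_det (q : 'I_n -> {poly F}) :
  mumbral h (\det (\matrix_(i, j) psubst (q i) 'X_j)) =
  \det (\matrix_(i, j) umbral (h j) (q i)).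
Proof.
rewrite -det_tr -[RHS]det_tr raddf_sum; apply: eq_bigr => s _ /=.
under eq_bigr do rewrite !mxE.
under [in RHS]eq_bigr do rewrite !mxE.
rewrite -(mumbral_prod (fun j => q (s j))).
by case: (s : bool); rewrite ?expr1 ?mulN1r ?raddfN ?expr0 ?mul1r.
Qed.

End Multivariate.

(** As for [mumbral_det]; the constant columns contribute only scalars, which pass through by
    linearity. *)
Lemma mumbral_det_row K M (h : 'I_K -> nat -> S) (q : 'I_(K + M) -> {poly F})
    (C : 'M[F]_(K + M, M)) :
  mumbral h (\det (row_mx (\matrix_(i, j) psubst (q i) 'X_j)
                          (map_mx (@mpolyC K F) C))) =
  \det (row_mx (\matrix_(i, j) umbral (h j) (q i)) (map_mx iota C)).
Proof.
rewrite -det_tr -[RHS]det_tr raddf_sum; apply: eq_bigr => s _ /=.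
rewrite !big_split_ord /=.
under eq_bigr do rewrite mxE row_mxEl mxE.
under [\prod_(j < M) _]eq_bigr do rewrite mxE row_mxEr mxE.
under [in RHS]eq_bigr do rewrite mxE row_mxEl mxE.
under [\prod_(j < M) _ in RHS]eq_bigr do rewrite mxE row_mxEr mxE.
rewrite -(mumbral_prod h (fun j => q (s (lshift M j)))).
rewrite -!rmorph_prod /= [in LHS](mulrC (\prod_j _)) mul_mpolyC.
rewrite [X in _ = _ * X]mulrC -mumbralZ.
by case: (s : bool); rewrite ?expr1 ?mulN1r ?mulrN1 ?mulNr ?raddfN ?expr0 ?mul1r ?mulr1.
Qed.

End Umbral.

(** * Vandermonde and Cauchy-Vandermonde determinants *)

Section PolynomialDeterminants.

Definition vandet (S : comNzRingType) n (s : 'I_n -> S) : S :=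
  \prod_(i < n) \prod_(j < n | (i < j)%N) (s i - s j).

(** The sign relating the differences [s i - s j] with [i < j], used throughout, to the opposite
    differences in [det_Vandermonde]. *)
Definition vansign (S : comNzRingType) n : S :=
  \prod_(i < n) \prod_(j < n | (i < j)%N) (- 1).

Lemma vansign_neq0 (S : idomainType) n : vansign S n != 0.
Proof.
by apply/prodf_neq0 => i _; apply/prodf_neq0 => j _; rewrite oppr_eq0 oner_eq0.
Qed.

(** The matrix of values is a Vandermonde matrix times the matrix of coefficients. *)
Lemma det_horner (S : comNzRingType) n (r : 'I_n -> {poly S}) (s : 'I_n -> S) :
    (forall j, size (r j) <= n)%N ->
  \det (\matrix_(i, j) (r j).[s i]) =
  \det (\matrix_(k, j) (r j)`_k) * vansign S n * vandet s.
Proof.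
move=> rn.
have -> : \matrix_(i, j) (r j).[s i] =
    (Vandermonde n (\row_i s i))^T *m \matrix_(k, j) (r j)`_k.
  apply/matrixP => i j; rewrite !mxE (horner_coef_wide _ (rn j)).
  by apply: eq_bigr => k _; rewrite !mxE mulrC.
rewrite det_mulmx det_tr det_Vandermonde mulrC -mulrA; congr (_ * _).
rewrite -big_split /=; apply: eq_bigr => i _.
rewrite -big_split /=; apply: eq_bigr => j _.
by rewrite !mxE mulN1r opprB.
Qed.

(** Reversing the rows makes the matrix lower triangular, with the leading coefficients on the
    diagonal. *)
Lemma det_coef_neq0 (S : idomainType) n (r : 'I_n -> {poly S}) :
    (forall j, size (r j) = n - j)%N ->
  \det (\matrix_(k < n, j < n) (r j)`_k) != 0.
Proof.
move=> rn; set C := \matrix_(k, j) _.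
have detC : \det (row_perm (perm (@rev_ord_inj n)) C) != 0.
  rewrite det_trig.
    apply/prodf_neq0 => j _; rewrite !mxE permE /=.
    have : r j != 0 by rewrite -size_poly_eq0 rn -lt0n subn_gt0.
    by rewrite -lead_coef_eq0 lead_coefE rn subnS.
  apply/is_trig_mxP => i j ij; rewrite !mxE permE /= nth_default // rn.
  by rewrite leq_sub2l.
by apply: contraNneq detC => C0; rewrite row_permE det_mulmx C0 mulr0.
Qed.

Lemma size_prod_CsubX (S : idomainType) (I : finType) (P : pred I) (u : I -> S) :
  (size (\prod_(j | P j) ((u j)%:P - 'X))%R <= #|P|.+1)%N.
Proof.
apply: (leq_trans (size_prod_leq _ _)).
rewrite leq_subLR -addSnnS addSn ltnS.
have -> : (#|P| + #|P|)%N = (\sum_(j | P j) 2)%N by rewrite sum_nat_const muln2 addnn.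
apply: leq_sum => j _.
by rewrite -opprB size_polyN size_XsubC.
Qed.

(** Multiplying row [i] by the product of the [u j - s i] clears the denominators. The entries
    become values at [s i] of polynomials of size at most [K + M] that do not involve [s], so
    [det_horner] applies, and [e] is their coefficient determinant up to sign. What matters later is
    that [e] does not depend on [s]. *)
Lemma cauchy_vandermonde_det (S : fieldType) K M (u : 'I_K -> S) (p : {poly S})
    (r : 'I_M -> {poly S}) :
    (size p <= M.+1)%N -> (forall j, size (r j) <= M)%N ->
  exists e : S, forall s : 'I_(K + M) -> S, (forall i j, u j - s i != 0) ->
    \det (row_mx (\matrix_(i, j) (p.[s i] / (u j - s i)))
                 (\matrix_(i, j) (r j).[s i])) =
    e * vandet s / \prod_i \prod_j (u j - s i).
Proof.
move=> pM rM.
pose R (j : 'I_(K + M)) := match fintype.split j with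
  | inl j => p * \prod_(l | l != j) ((u l)%:P - 'X)
  | inr j => r j * \prod_l ((u l)%:P - 'X) end.
have RM j : (size (R j) <= K + M)%N.
  rewrite /R; case: split_ordP => l _; apply: (leq_trans (size_polyMleq _ _)).
    have := leq_add pM (size_prod_CsubX (predC1 l) u).
    rewrite cardC1 card_ord (ltn_predK (ltn_ord l)) addSn => le.
    by rewrite -subn1 leq_subLR add1n [(K + M)%N]addnC.
  have := leq_add (rM l) (size_prod_CsubX predT u).
  rewrite cardT size_enum_ord addnS => le.
  by rewrite -subn1 leq_subLR add1n [(K + M)%N]addnC.
exists (\det (\matrix_(k, j) (R j)`_k) * vansign S (K + M)) => s us.
have P0 : \prod_i \prod_j (u j - s i) != 0.
  by apply/prodf_neq0 => i _; apply/prodf_neq0.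
apply: (canRL (mulfK P0)).
rewrite -(det_horner s RM) mulrC.
have -> : \prod_i \prod_j (u j - s i)
    = \det (diag_mx (\row_i \prod_j (u j - s i))).
  by rewrite det_diag; apply: eq_bigr => i _; rewrite mxE.
rewrite -det_mulmx; congr (\det _); apply/matrixP => i j.
rewrite mul_diag_mx !mxE /R.
have evC l : ((u l)%:P - 'X).[s i] = u l - s i by rewrite !hornerE.
case: split_ordP => l _; rewrite !mxE ?hornerM horner_prod.
  rewrite (bigD1 l) //= (eq_bigr _ (fun l _ => evC l)).
  by rewrite mulrAC mulrCA mulfV ?mulr1 // mulrC.
by rewrite (eq_bigr _ (fun l _ => evC l)) mulrC.
Qed.

End PolynomialDeterminants.

(** * Jacobi polynomials in the Newton basis *)

Section Newton.
Variable S : idomainType.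
Implicit Types (c : nat -> S) (x : S).

Definition newton c m : {poly S} := \prod_(i < m) ('X - (c i)%:P).

Lemma size_newton c m : size (newton c m) = m.+1.
Proof. by rewrite size_prod_XsubC /index_enum -enumT size_enum_ord. Qed.

Lemma newtonE c m x : (newton c m).[x] = \prod_(i < m) (x - c i).
Proof. by rewrite horner_prod; apply: eq_bigr => i _; rewrite !hornerE. Qed.

Lemma newtonS c m x : (newton c m.+1).[x] = (newton c m).[x] * (x - c m).
Proof. by rewrite !newtonE big_ord_recr. Qed.

Lemma newton_node c m n : (n < m)%N -> (newton c m).[c n] = 0.
Proof.
by move=> nm; rewrite newtonE (bigD1 (Ordinal nm)) //= subrr mul0r.
Qed.

End Newton.

(** Telescoping: [u - x] times the summand is the difference of two consecutive quotients of Newton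
    polynomials, as [u - x = (u - c m) - (x - c m)]. *)
Lemma newton_sum (S : fieldType) (c : nat -> S) M d (x u : S) :
    (forall i, u != c i) -> u != x ->
  \sum_(m < d) (newton c (m + M)).[x] / (newton c (m + M).+1).[u] =
  ((newton c M).[x] / (newton c M).[u] -
   (newton c (d + M)).[x] / (newton c (d + M)).[u]) / (u - x).
Proof.
move=> uc ux; have ux0 : u - x != 0 by rewrite subr_eq0.
have nz m : (newton c m).[u] != 0.
  by rewrite newtonE; apply/prodf_neq0 => i _; rewrite subr_eq0.
elim: d => [|d IHd]; first by rewrite big_ord0 subrr mul0r.
rewrite big_ord_recr /= {}IHd addSn !newtonS.
have := nz (d + M)%N; have := nz M; have : u - c (d + M)%N != 0 by rewrite subr_eq0.
by move=> *; field; rewrite ux0; do ?[apply/andP; split].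
Qed.

Section JacobiAtOne.
Variables (F : realFieldType) (a b eps : F).
Hypotheses (a_gtN1 : -1 < a) (eps_ge0 : 0 <= eps) (epsE : a + b + 1 = eps *+ 2).

Definition node n : F := (n%:R + eps) ^+ 2.

Definition weight m : F := (-1) ^+ m / (poch (a + 1) m * (m`!)%:R).

(* The normalized Jacobi polynomial in the variable (1 - x) / 2. *)
Definition jac n : {poly F} :=
  \poly_(m < n.+1) ((newton node m).[node n] * weight m).

(** The classical value of P_n^(a,b) at 1, which [jac] divides out. *)
Definition jac_scale n : F := poch (a + 1) n / (n`!)%:R.

Lemma node_inj : injective node.
Proof.
move=> m n /eqP; rewrite /node eqrXn2 ?addr_ge0 // => /eqP/addIr/eqP.
by rewrite eqr_nat => /eqP.
Qed.

Lemma poch_gt0 (x : F) m : 0 < x -> 0 < poch x m.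
Proof. by move=> x0; apply: prodr_gt0 => i _; rewrite ltr_wpDr. Qed.

Lemma factr_neq0 m : (m`!)%:R != 0 :> F.
Proof. by rewrite pnatr_eq0 -lt0n fact_gt0. Qed.

Lemma poch_a_neq0 m : poch (a + 1) m != 0.
Proof. by rewrite gt_eqF // poch_gt0 // -ltrBlDr sub0r. Qed.

Lemma weight_neq0 m : weight m != 0.
Proof.
by rewrite mulf_neq0 ?signr_eq0 // invr_eq0 mulf_neq0 ?poch_a_neq0 ?factr_neq0.
Qed.

Lemma jac_scale_neq0 n : jac_scale n != 0.
Proof. by rewrite mulf_neq0 ?poch_a_neq0 // invr_eq0 factr_neq0. Qed.

Lemma newton_node_gt0 n m : (m <= n)%N -> 0 < (newton node m).[node n].
Proof.
move=> mn; rewrite newtonE; apply: prodr_gt0 => i _.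
rewrite subr_gt0 /node ltrXn2r ?nnegrE ?addr_ge0 // ltrD2r ltr_nat.
by rewrite (leq_trans (ltn_ord i)).
Qed.

Lemma coef_jac n m : (jac n)`_m = (newton node m).[node n] * weight m.
Proof.
by rewrite coef_poly; case: ltnP => // /newton_node ->; rewrite mul0r.
Qed.

Lemma size_jac n : size (jac n) = n.+1.
Proof.
by rewrite size_poly_eq // mulf_neq0 ?weight_neq0 // gt_eqF // newton_node_gt0.
Qed.

(** Factor by factor, (i - n)(n + i + 2 eps) = -(l_n - l_i) with l_n = (n + eps)^2. This is why the
    Newton basis on the nodes l_i appears. *)
Lemma poch_pair n m :
  poch (- n%:R) m * poch (n%:R + eps *+ 2) m =
  (-1) ^+ m * (newton node m).[node n].
Proof.
rewrite /poch newtonE -big_split /= -[m in (-1) ^+ m]card_ord -prodr_const.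
by rewrite -big_split /=; apply: eq_bigr => i _; rewrite /node; ring.
Qed.

Lemma jacobiE n : jacobi a b n =
  jac_scale n *: (jac n \Po (2^-1 *: (1 - 'X))).
Proof.
rewrite /jacobi comp_polyE size_jac; congr (_ *: _); apply: eq_bigr => m _.
rewrite coef_jac /hyp_coef !big_cons !big_nil !mulr1.
have -> : n%:R + a + b + 1 = n%:R + eps *+ 2 by rewrite -epsE; ring.
by rewrite poch_pair /weight; congr (_ *: _); ring.
Qed.

(** The substitution x = 1 - 2y, under which the point x = 1 becomes y = 0. *)
Definition one_minus2 n : n.-tuple {mpoly F[n]} :=
  [tuple 1 - 'X_j *+ 2 | j < n].

Lemma psubst_comp_poly n (q r : {poly F}) (x : {mpoly F[n]}) :
  psubst (q \Po r) x = psubst q (psubst r x).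
Proof. by rewrite /psubst map_comp_poly horner_comp. Qed.

Lemma psubstZ n c (q : {poly F}) (x : {mpoly F[n]}) :
  psubst (c *: q) x = c *: psubst q x.
Proof. by rewrite /psubst map_polyZ hornerZ mul_mpolyC. Qed.

Lemma psubst_jacobi n N (j : 'I_N) :
  psubst (jacobi a b n) (1 - 'X_j *+ 2) = jac_scale n *: psubst (jac n) 'X_j.
Proof.
rewrite jacobiE psubstZ psubst_comp_poly psubstZ.
congr (_ *: psubst _ _).
rewrite /psubst rmorphB /= map_polyX rmorph1 !hornerE opprB addrC addrNK.
by rewrite -scaler_nat scalerA mulVf ?scale1r // pnatr_eq0.
Qed.

Definition jac_det N (nu : signature N) : {mpoly F[N]} :=
  \det (\matrix_(i < N, j < N) psubst (jac (shifted nu i)) 'X_j).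

Definition jac_vandet N (nu : signature N) : F :=
  vandet (fun i => node (shifted nu i)).

(** The factor of [jac_value] that does not depend on the signature; it cancels in every ratio of
    two such values. *)
Definition newton_coef_det N : F :=
  \det (\matrix_(k < N, j < N)
    ((weight (N - j.+1) *: newton node (N - j.+1))`_k)) * vansign F N.

Lemma newton_coef_det_neq0 N : newton_coef_det N != 0.
Proof.
rewrite mulf_neq0 ?vansign_neq0 //; apply: (@det_coef_neq0 F N
  (fun j => weight (N - j.+1) *: newton node (N - j.+1))) => j.
by rewrite size_scale ?weight_neq0 // size_newton subnSK.
Qed.

Lemma shifted_mono N (nu : signature N) (i j : 'I_N) :
  (i < j)%N -> (shifted nu j < shifted nu i)%N.
Proof.
move=> ij; rewrite /shifted -addnS leq_add //; last first.
  by rewrite subnSK // leq_sub2l.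
rewrite /part !(tnth_nth 0%N).
have geq_trans : transitive geq by move=> x y z /[swap]; apply: leq_trans.
have := sorted_leq_nth geq_trans leqnn 0%N (svalP nu).
by move=> /(_ i j); rewrite !inE !size_tuple; apply; rewrite // ltnW.
Qed.

Lemma jac_vandet_neq0 N (nu : signature N) : jac_vandet nu != 0.
Proof.
apply/prodf_neq0 => i _; apply/prodf_neq0 => j ij; rewrite subr_eq0.
by apply: contraTneq (shifted_mono nu ij) => /node_inj ->; rewrite ltnn.
Qed.

(** The value at y = 0 of [jac_det] divided by the Vandermonde product, in factored form; see
    [jac_quotient_at0]. *)
Definition jac_value N (nu : signature N) : F :=
  newton_coef_det N * jac_vandet nu.

Lemma jac_value_neq0 N (nu : signature N) : jac_value nu != 0.
Proof. by rewrite mulf_neq0 ?newton_coef_det_neq0 ?jac_vandet_neq0. Qed.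

(** By [coef_jac] the entries are values of weighted Newton polynomials at the nodes of [nu], so
    [det_horner] factors the determinant. *)
Lemma jac_valueE N (nu : signature N) :
  jac_value nu = \det (\matrix_(i < N, j < N) (jac (shifted nu i))`_(N - j.+1)).
Proof.
rewrite /jac_value /newton_coef_det -det_horner.
  congr (\det _); apply/matrixP => i j.
  by rewrite !mxE coef_jac hornerZ mulrC.
by move=> j; rewrite size_scale ?weight_neq0 // size_newton subnSK // leq_subr.
Qed.

(** The extreme case of [confluent_det], with all variables set to 0: the product of differences is
    empty and the determinant consists of coefficients. *)
Lemma jac_quotient_at0 N (nu : signature N) (Q : {mpoly F[N]}) :
  Q * vandermonde_prod F N = jac_det nu -> Q.@[fun=> 0] = jac_value nu.
Proof.
move=> /confluent_det/(_ (leqnn N))/(congr1 (meval (fun=> 0))).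
rewrite mevalM comp_mpoly_meval => eqQ.
transitivity (Q.@[fun i => (tnth (zero_tail F N N) i).@[fun=> 0]]).
  by apply: meval_eq => i; rewrite tnth_mktuple subnn meval0.
move: eqQ; rewrite big1 => [|i _]; last first.
  by rewrite big1 // => j; rewrite subnn andbF.
rewrite meval1 mulr1 => ->; rewrite jac_valueE -det_map_mx.
by congr (\det _); apply/matrixP => i j; rewrite !mxE subnn /= mevalC.
Qed.

(** The change of variables multiplies each difference by -2, and each row carries a factor
    [jac_scale]. Normalization at x = 1, that is at y = 0, removes both constants. *)
Lemma jacobi_norm_comp N (nu : signature N) :
  (jacobi_norm a b nu \mPo one_minus2 N) * vandermonde_prod F N =
  (jac_value nu)^-1 *: jac_det nu.
Proof.
pose c := \prod_(i < N) \prod_(j < N | (i < j)%N) (- 2 : F).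
pose s := \prod_(i < N) jac_scale (shifted nu i).
have c0 : c != 0.
  by apply/prodf_neq0 => i _; apply/prodf_neq0 => j _; rewrite oppr_eq0 pnatr_eq0.
have s0 : s != 0 by apply/prodf_neq0 => i _; apply: jac_scale_neq0.
set P := jacobi_mv a b nu \mPo one_minus2 N.
have PV : P * (c *: vandermonde_prod F N) = s *: jac_det nu.
  have -> : c *: vandermonde_prod F N = vandermonde_prod F N \mPo one_minus2 N.
    rewrite /c /vandermonde_prod rmorph_prod -scaler_prod; apply: eq_bigr => i _.
    rewrite rmorph_prod -scaler_prod; apply: eq_bigr => j _ /=.
    rewrite comp_mpolyB !comp_mpolyXt !tnth_mktuple -mul_mpolyC mpolyCN mpolyC_nat.
    by ring.
  rewrite -rmorphM jacobi_mvE /jacobi_det /= -det_map_mx.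
  have -> : s *: jac_det nu = (\det (diag_mx (\row_i (jac_scale (shifted nu i))%:MP)))
                              * jac_det nu.
    rewrite det_diag -mul_mpolyC /s rmorph_prod; congr (_ * _).
    by apply: eq_bigr => i _; rewrite mxE.
  rewrite -det_mulmx; congr (\det _); apply/matrixP => i j.
  rewrite mul_diag_mx !mxE mul_mpolyC -psubst_jacobi.
  rewrite -/(psubst (jacobi a b (shifted nu i)) 'X_j) /=.
  by rewrite psubst_comp comp_mpolyXt tnth_mktuple.
have QV : ((c / s) *: P) * vandermonde_prod F N = jac_det nu.
  rewrite -scalerAl [c / s]mulrC -scalerA scalerAr PV.
  by rewrite scalerA mulVf // scale1r.
have := jac_quotient_at0 QV; rewrite mevalZ => valQ.
rewrite -{}QV -{}valQ /jacobi_norm comp_mpolyZ -/P.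
have -> : P.@[fun=> 0] = (jacobi_mv a b nu).@[fun=> 1].
  rewrite comp_mpoly_meval; apply: meval_eq => i.
  by rewrite tnth_mktuple mevalB meval1 mevalMn mevalXU mul0rn subr0.
rewrite -!scalerAl scalerA invfM mulrAC mulVf ?mul1r //.
by rewrite mulf_neq0 ?invr_eq0.
Qed.

End JacobiAtOne.

(** * Specializing the last M variables *)

Section Padding.
Variables (F : realFieldType) (K M : nat).

Definition head_vars : (K + M).-tuple {mpoly F[K]} :=
  [tuple if fintype.split i is inl k then 'X_k else 0 | i < K + M].

Lemma pad_ones_comp (p : {mpoly F[K + M]}) :
  (p \mPo pad_ones F (K + M) K) \mPo one_minus2 F K =
  (p \mPo one_minus2 F (K + M)) \mPo head_vars.
Proof.
rewrite !comp_mpolyA; congr (_ \mPo _); apply: eq_from_tnth => i.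
rewrite !tnth_mktuple comp_mpolyB comp_mpolyMn comp_mpoly1 comp_mpolyXt tnth_mktuple.
case: split_ordP => k -> /=.
  by rewrite valK comp_mpolyXt tnth_mktuple.
by rewrite insubF ?comp_mpoly1 ?mul0rn ?subr0 // ltnNge leq_addr.
Qed.

(** This is [confluent_det] for [r = M], read in the [K] remaining variables. Column [K + j] holds
    the coefficients of index [K + M - (K + j).+1 = M - j.+1]. *)
Lemma confluent_det_head (q : 'I_(K + M) -> {poly F}) (Q : {mpoly F[K + M]}) :
    Q * vandermonde_prod F (K + M) = \det (\matrix_(i, j) psubst (q i) 'X_j) ->
  (Q \mPo head_vars) * vandermonde_prod F K =
  \det (row_mx (\matrix_(i, j) psubst (drop_poly M (q i)) 'X_j)
          (map_mx (@mpolyC K F) (\matrix_(i < K + M, j < M) (q i)`_(M - j.+1)))).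
Proof.
have headl k : 'X_(lshift M k) \mPo head_vars = 'X_k.
  by rewrite comp_mpolyXt tnth_mktuple (unsplitK (inl k)).
move=> /confluent_det/(_ (leq_addl K M))/(congr1 (comp_mpoly head_vars)).
rewrite rmorphM /= comp_mpolyA addnK.
have -> : [tuple tnth (zero_tail F (K + M) M) i \mPo head_vars | i < K + M]
          = head_vars.
  apply: eq_from_tnth => i; rewrite !tnth_mktuple addnK.
  case: split_ordP => k ek; last by rewrite comp_mpoly0.
  by rewrite ek headl.
move=> eqQ; transitivity (\det (map_mx (comp_mpoly head_vars)
  (\matrix_(i, j) if (j < K)%N then psubst (drop_poly M (q i)) 'X_j
                  else ((q i)`_(K + M - j.+1))%:MP))).
  rewrite det_map_mx /= -{}eqQ; congr (_ * _).
  rewrite rmorph_prod big_split_ord /= [X in _ = _ * X]big1 ?mulr1; last first.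
    move=> i _; rewrite big_pred0 ?rmorph1 // => j.
    by rewrite ltnNge andbC; case: ltnP => // jK; rewrite (leq_trans (ltnW jK)) ?leq_addr.
  apply: eq_bigr => i _; rewrite rmorph_prod big_split_ord /= [X in _ = _ * X]big1 ?mulr1.
    apply: eq_big => [j|j _]; first by rewrite ltn_ord andbT.
    by rewrite rmorphB /= !headl.
  by move=> j; rewrite [X in _ && X]ltnNge leq_addr andbF.
congr (\det _); apply/matrixP => i j; rewrite !mxE.
case: split_ordP => k ek; rewrite !mxE ek.
  by rewrite psubst_comp headl.
by rewrite comp_mpolyC /= -addnS subnDl.
Qed.

End Padding.

(** * Constants and variables in the field of rational functions *)

Section RationalFunctions.
Variables (F : fieldType) (K : nat).

HB.instance Definition _ := GRing.RMorphism.copy (@rat_const F K)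
  (@FracField.tofrac {mpoly F[K]} \o @mpolyC K F).

(** Evaluation at 0 and at 1 tells the square of a variable from a constant. Hence the denominators
    t_j^2 - l_n are nonzero in the field. *)
Lemma rat_var_sqr_neq (j : 'I_K) (c : F) : rat_var F j ^+ 2 != rat_const K c.
Proof.
rewrite /rat_var /rat_const -rmorphXn /= tofrac_eq.
apply/eqP => eqc; have := congr1 (meval (fun=> 1)) eqc.
have := congr1 (meval (fun=> 0)) eqc.
rewrite !rmorphXn /= !mevalXU !mevalC expr0n expr1n /= => <- /eqP.
by rewrite oner_eq0.
Qed.

End RationalFunctions.

(** * Images of the Jacobi polynomials under the map from y^m to phi_m(t) *)

Section UmbralJacobi.
Variables (F : realFieldType) (a eps : F).
Hypotheses (a_gtN1 : -1 < a) (eps_ge0 : 0 <= eps).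
Variables (S : fieldType) (iota : {rmorphism F -> S}).
Let c i : S := iota (node eps i).

(* The image phi_m(t) of y^m. *)
Definition pole_fun (L : nat) (t : S) (m : nat) : S :=
  poch L%:R m * poch (L%:R + iota a) m /
  (poch (- t + L%:R + iota eps) m * poch (t + L%:R + iota eps) m).

Lemma rmorph_poch x m : iota (poch x m) = poch (iota x) m.
Proof.
rewrite rmorph_prod; apply: eq_bigr => i _.
by rewrite rmorphD rmorph_nat.
Qed.

(** The parameters -k, k + 2 eps and a + 1, with the factorial, give the coefficient of [jac] by
    [poch_pair], the two signs (-1)^m cancelling; the remaining parameters give [pole_fun]. *)
Lemma g_fun_umbral L k t :
  g_fun (iota a) (iota eps) L k t = umbral iota (pole_fun L t) (jac a eps k).
Proof.
rewrite /g_fun (umbralE _ _ (size_poly _ _)); apply: eq_bigr => m _.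
rewrite coef_jac /hyp_coef !big_cons !big_nil !mulr1 /pole_fun.
have := congr1 iota (poch_pair eps k m).
rewrite rmorphM !rmorph_poch rmorphN rmorphD !rmorph_nat rmorphMn /= mulrA => ->.
rewrite /weight !rmorphM /= !fmorphV !rmorphM /= rmorph_poch rmorphD rmorph1.
rewrite rmorph_nat.
by rewrite !invfM; ring.
Qed.

Lemma poch_pole L t m :
  poch (- t + L%:R + iota eps) m * poch (t + L%:R + iota eps) m =
  (-1) ^+ m * \prod_(i < m) (t ^+ 2 - c (L + i)).
Proof.
rewrite /poch -big_split /= -[m in (-1) ^+ m]card_ord -prodr_const.
rewrite -big_split /=; apply: eq_bigr => i _.
rewrite /c /node rmorphXn rmorphD rmorph_nat natrD /=; ring.
Qed.

Lemma pochD (R : fieldType) (x : R) m n :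
  poch x (m + n) = poch x m * poch (x + m%:R) n.
Proof.
rewrite /poch big_split_ord /=; congr (_ * _); apply: eq_bigr => i _.
by rewrite natrD addrA.
Qed.

Lemma poch_fact (R : fieldType) m n :
  ((m + n)`!)%:R = (m`!)%:R * poch (m.+1)%:R n :> R.
Proof.
rewrite /poch; elim: n => [|n IHn]; first by rewrite big_ord0 addn0 mulr1.
rewrite big_ord_recr addnS factS natrM {}IHn /= -addSn natrD; ring.
Qed.

Lemma newtonD (m n : nat) (x : S) :
  (newton c (m + n)).[x] = (newton c m).[x] * \prod_(i < n) (x - c (m + i)).
Proof. by rewrite !newtonE big_split_ord. Qed.

Lemma rmorph_newton m x : iota (newton (node eps) m).[x] = (newton c m).[iota x].
Proof.
by rewrite !newtonE rmorph_prod; apply: eq_bigr => i _; rewrite rmorphB.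
Qed.

(** The choice L = M + 1 matches the shift by [M] in [drop_poly]: the Pochhammer symbols in the
    numerator of [pole_fun] cancel those in [weight a (m + M)], and the rest is the sum evaluated by
    [newton_sum]. The result is a factor free of [n] times a Cauchy-type entry. *)
Lemma umbral_drop_jac M n t : (forall i, t ^+ 2 != c i) ->
  umbral iota (pole_fun M.+1 t) (drop_poly M (jac a eps n)) =
  iota (weight a M) * (newton c M.+1).[t ^+ 2] / (newton c M).[t ^+ 2] *
  ((newton c M).[c n] / (t ^+ 2 - c n)).
Proof.
move=> tc; rewrite (@umbralE _ _ _ n.+1); last first.
  by rewrite size_drop_poly size_jac // leq_subr.
have nz (A : S) m : (forall i, A != c i) -> (newton c m).[A] != 0.
  by move=> Ac; rewrite newtonE; apply/prodf_neq0 => i _; rewrite subr_eq0.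
transitivity (iota (weight a M) * (newton c M.+1).[t ^+ 2] *
    \sum_(m < n.+1) (newton c (m + M)).[c n] / (newton c (m + M).+1).[t ^+ 2]).
  rewrite mulr_sumr; apply: eq_bigr => m _.
  rewrite coef_drop_poly coef_jac rmorphM rmorph_newton -/(c n).
  have P0 : \prod_(i < m) (t ^+ 2 - c (M.+1 + i)) != 0.
    by apply/prodf_neq0 => i _; rewrite subr_eq0.
  have -> : (m + M).+1 = (M.+1 + m)%N by rewrite addnC.
  rewrite /pole_fun poch_pole [(newton c (M.+1 + m)).[_] ]newtonD.
  have -> : iota (weight a (m + M)) =
     iota (weight a M) * (-1) ^+ m / (poch M.+1%:R m * poch (M.+1%:R + iota a) m).
    rewrite /weight addnC exprD pochD poch_fact.
    rewrite !rmorphM /= !fmorphV !rmorphM /= !rmorph_poch rmorph_nat.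
    rewrite !rmorphXn !rmorphN !rmorphD !rmorph1 !rmorph_nat -![M.+1%:R]natr1.
    have -> : M%:R + 1 + iota a = iota a + 1 + M%:R by ring.
    by rewrite !invfM; ring.
  have e1 : poch M.+1%:R m != 0 :> S.
    have := factr_neq0 F (M + m); rewrite poch_fact mulf_eq0 negb_or => /andP[_].
    by rewrite -(fmorph_eq0 iota) rmorph_poch rmorph_nat.
  have e2 : poch (M.+1%:R + iota a) m != 0.
    rewrite -(rmorph_nat iota) -rmorphD -rmorph_poch fmorph_eq0 gt_eqF // poch_gt0 //.
    by rewrite -natr1 -addrA ltr_wpDl // -ltrBlDl sub0r.
  have e3 := nz _ M.+1 tc; field.
  by rewrite P0 e1 e2 e3 signr_eq0.
(* The upper end of the telescoping sum vanishes, since [c n] is a root of the Newton polynomial of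
   degree [n.+1 + M]. *)
rewrite newton_sum //= (@newton_node _ c (n.+1 + M) n); last by rewrite addSn ltnS leq_addr.
by rewrite mul0r subr0 !mulrA; ring.
Qed.

End UmbralJacobi.
(** * The transformed branching identity *)

Section TransformedIdentity.
Variables (F : realFieldType) (a b eps : F).
Hypotheses (a_gtN1 : -1 < a) (eps_ge0 : 0 <= eps) (epsE : a + b + 1 = eps *+ 2).

Lemma jacobi_norm_pad K M (nu : signature (K + M)) :
  ((jacobi_norm a b nu \mPo pad_ones F (K + M) K) \mPo one_minus2 F K) *
    vandermonde_prod F K =
  (jac_value a eps nu)^-1 *:
  \det (row_mx
    (\matrix_(i, j) psubst (drop_poly M (jac a eps (shifted nu i))) 'X_j)
    (map_mx (@mpolyC K F)
       (\matrix_(i < K + M, j < M) (jac a eps (shifted nu i))`_(M - j.+1)))).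
Proof.
have value0 := jac_value_neq0 a_gtN1 eps_ge0 nu.
rewrite pad_ones_comp -(confluent_det_head (Q := jac_value a eps nu *:
  (jacobi_norm a b nu \mPo one_minus2 F (K + M)))); last first.
  rewrite -scalerAl (jacobi_norm_comp a_gtN1 eps_ge0 epsE).
  by rewrite scalerA mulfV ?scale1r.
move: (_ \mPo one_minus2 F (K + M)) => P.
by rewrite comp_mpolyZ -scalerAl scalerA mulVf ?scale1r.
Qed.

Lemma signature0_subproof N : sorted geq (nseq_tuple N 0).
Proof. by elim: N => [|[|N]] //=. Qed.

Definition signature0 N : signature N := Sub (nseq_tuple N 0) (signature0_subproof N).

Lemma shifted0 N (i : 'I_N) : shifted (signature0 N) i = (N - i.+1)%N.
Proof. by rewrite /shifted /part (tnth_nth 0%N) /= nth_nseq ltn_ord. Qed.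

(** For the zero signature the polynomials have degree below [N], so [det_horner] makes [jac_det] a
    scalar multiple of the Vandermonde product. The quotient is thus constant, and its value at y =
    0 is 1. *)
Lemma jacobi_norm0 N :
  jacobi_norm a b (signature0 N) \mPo one_minus2 F N = 1.
Proof.
set nu := signature0 N; set P := _ \mPo _.
have value0 := jac_value_neq0 a_gtN1 eps_ge0 nu.
have PV : P * vandermonde_prod F N = (jac_value a eps nu)^-1 *: jac_det a eps nu.
  exact: jacobi_norm_comp.
pose r (j : 'I_N) := jac a eps (shifted nu j).
pose e := \det (\matrix_(k < N, j < N) (r j)`_k) * vansign F N.
have detE : jac_det a eps nu = e *: vandermonde_prod F N.
  have rN j : (size (map_poly (@mpolyC N F) (r j)) <= N)%N.
    by rewrite (leq_trans (size_poly _ _)) // size_jac // shifted0 subnSK // leq_subr.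
  have := det_horner (fun j => 'X_j) rN; rewrite -det_tr.
  rewrite -[vandet _]/(vandermonde_prod F N) => detV.
  rewrite -mul_mpolyC /e; transitivity (\det
    (\matrix_(i, j) (map_poly (@mpolyC N F) (r j)).['X_i])^T).
    by congr (\det _); apply/matrixP => i j; rewrite !mxE.
  rewrite {}detV; congr (_ * _); rewrite mpolyCM; congr (_ * _).
    rewrite -det_map_mx.
    by congr (\det _); apply/matrixP => i j; rewrite !mxE coef_map.
  rewrite /vansign rmorph_prod; apply: eq_bigr => i _.
  by rewrite rmorph_prod; apply: eq_bigr => j _; rewrite rmorphN1.
have PE : P = ((jac_value a eps nu)^-1 * e)%:MP.
  apply: (mulIf (vandermonde_prod_neq0 F N)).
  by rewrite PV detE mul_mpolyC scalerA.
have := @jac_quotient_at0 _ a eps a_gtN1 _ nu (jac_value a eps nu *: P).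
rewrite -scalerAl PV scalerA mulfV // scale1r => /(_ erefl).
rewrite mevalZ -[RHS]mulr1 => /(mulfI value0); rewrite {1}PE mevalC => e1.
by rewrite PE e1.
Qed.

Section Transform.
Variables K M : nat.
Let iota : {rmorphism F -> ratfun F K} := @rat_const F K.
Let t (j : 'I_K) : ratfun F K := rat_var F j.

(** Only a linear map. It is therefore applied after multiplication by the Vandermonde product, when
    the polynomials are determinants. *)
Definition transform : {mpoly F[K]} -> ratfun F K :=
  mumbral iota (fun j => pole_fun a eps iota M.+1 (rat_var F j)).

Lemma transform_jacobi (kappa : signature K) :
  transform ((jacobi_norm a b kappa \mPo one_minus2 F K) * vandermonde_prod F K) =
  iota (jac_value a eps kappa)^-1 *
  \det (\matrix_(i, j)
     g_fun (rat_const K a) (rat_const K eps) M.+1 (shifted kappa i) (rat_var F j)).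
Proof.
rewrite (jacobi_norm_comp a_gtN1 eps_ge0 epsE) /transform mumbralZ mumbral_det.
congr (_ * \det _); apply/matrixP => i j; rewrite !mxE.
by rewrite (g_fun_umbral a eps iota).
Qed.

(** The Cauchy-Vandermonde determinant produces the Vandermonde product of the nodes of [nu], which
    cancels the one in [jac_value]; [E] gathers what is independent of [nu]. *)
Lemma transform_pad :
  exists E : ratfun F K, forall nu : signature (K + M),
  transform (((jacobi_norm a b nu \mPo pad_ones F (K + M) K)
                \mPo one_minus2 F K) * vandermonde_prod F K) =
  E / \prod_i \prod_j (t j ^+ 2 - iota (node eps (shifted nu i))).
Proof.
pose c i := iota (node eps i).
pose u (j : 'I_K) := t j ^+ 2.
pose r (j : 'I_M) := iota (weight a (M - j.+1)) *: newton c (M - j.+1).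
have rM j : (size (r j) <= M)%N.
  by rewrite size_scale ?fmorph_eq0 ?weight_neq0 // size_newton subnSK // leq_subr.
have pM : (size (newton c M) <= M.+1)%N by rewrite size_newton.
have [e He] := cauchy_vandermonde_det u pM rM.
pose W j := iota (weight a M) * (newton c M.+1).[u j] / (newton c M).[u j].
exists (iota (newton_coef_det a eps (K + M))^-1 * (e * \prod_j W j)) => nu.
have uc i j : u j - c i != 0 by rewrite subr_eq0 rat_var_sqr_neq.
rewrite jacobi_norm_pad /transform mumbralZ mumbral_det_row.
set B := row_mx _ _.
pose s i := c (shifted nu i).
(* By [umbral_drop_jac], the factor [W j] comes out of column [j] of the left block. *)
have -> : B = row_mx (\matrix_(i, j) ((newton c M).[s i] / (u j - s i)))
                     (\matrix_(i, j) (r j).[s i]) *m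
              block_mx (diag_mx (\row_j W j)) 0 0 1%:M.
  rewrite mul_row_block !mulmx0 mulmx1 addr0 add0r mul_mx_diag /B; congr row_mx.
    apply/matrixP => i j; rewrite !mxE umbral_drop_jac //; last first.
      by move=> k; rewrite rat_var_sqr_neq.
    by rewrite mulrC.
  apply/matrixP => i j; rewrite !mxE coef_jac rmorphM rmorph_newton.
  by rewrite hornerZ mulrC.
rewrite det_mulmx det_ublock det1 mulr1 det_diag He; last by move=> i j; apply: uc.
have -> : \prod_j (\row_j W j) 0 j = \prod_j W j.
  by apply: eq_bigr => j _; rewrite mxE.
have -> : vandet s = iota (jac_vandet eps nu).
  rewrite /jac_vandet /vandet rmorph_prod; apply: eq_bigr => i _.
  by rewrite rmorph_prod; apply: eq_bigr => j _; rewrite rmorphB.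
rewrite /jac_value invfM rmorphM !fmorphV.
have v0 : iota (jac_vandet eps nu) != 0 by rewrite fmorph_eq0 jac_vandet_neq0.
rewrite -!mulrA; congr (_ * _); rewrite [LHS]mulrCA; congr (_ * _).
by rewrite mulKf // mulrC.
Qed.

(** [E] is eliminated by comparison with the zero signature, whose normalized polynomial is 1; its
    nodes are the ones in the numerators of [F_prod]. *)
Lemma transform_F_prod (nu : signature (K + M)) :
  transform (((jacobi_norm a b nu \mPo pad_ones F (K + M) K)
                \mPo one_minus2 F K) * vandermonde_prod F K) =
  \prod_(j < K) F_prod (rat_var F j) nu (rat_const K eps) *
  transform (vandermonde_prod F K).
Proof.
have [E HE] := transform_pad.
have pad0 : ((jacobi_norm a b (signature0 (K + M)) \mPo pad_ones F (K + M) K)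
    \mPo one_minus2 F K) * vandermonde_prod F K = vandermonde_prod F K.
  by rewrite pad_ones_comp jacobi_norm0 comp_mpoly1 mul1r.
have E0 := etrans (congr1 transform (esym pad0)) (HE (signature0 (K + M))).
apply: (etrans (HE nu)); apply: (etrans _ (congr1 ( *%R _) (esym E0))).
have nz (mu : signature (K + M)) :
    \prod_i \prod_j (t j ^+ 2 - iota (node eps (shifted mu i))) != 0.
  apply/prodf_neq0 => i _; apply/prodf_neq0 => j _.
  by rewrite subr_eq0 rat_var_sqr_neq.
have FE : \prod_(j < K) F_prod (rat_var F j) nu (rat_const K eps) =
  \prod_i \prod_j (t j ^+ 2 - iota (node eps (shifted (signature0 (K + M)) i))) /
  \prod_i \prod_j (t j ^+ 2 - iota (node eps (shifted nu i))).
  rewrite -prodf_div exchange_big /=; apply: eq_bigr => i _; rewrite -prodf_div.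
  apply: eq_bigr => j _; rewrite shifted0 /node !rmorphXn !rmorphD !rmorph_nat //.
have swap (x p q : ratfun F K) : p != 0 -> x / q = p / q * (x / p).
  by move=> p0; rewrite mulrACA [p * x]mulrC mulrACA mulfV // mulr1.
by rewrite FE; apply: swap; apply: nz.
Qed.

End Transform.

End TransformedIdentity.
(** * Linear independence *)

Lemma shifted_inj K (kappa mu : signature K) :
  shifted kappa =1 shifted mu -> kappa = mu.
Proof.
move=> eqs; apply: val_inj; apply: eq_from_tnth => i.
by have /eqP := eqs i; rewrite /shifted eqn_add2r => /eqP.
Qed.

(** The shifted parts are strictly decreasing, so they are determined by their set of values; an
    inclusion between two sets of [K] elements is an equality. *)
Lemma shifted_codom_inj K (kappa mu : signature K) :
  (forall i, exists j, shifted kappa i = shifted mu j) -> kappa = mu.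
Proof.
move=> sub; pose t (la : signature K) := [tuple shifted la i | i < K].
have mono la : sorted gtn (t la).
  apply/(sortedP 0%N) => i; rewrite size_tuple => iK.
  have nthE (o : 'I_K) : nth 0%N (t la) o = shifted la o.
    by rewrite -tnth_nth tnth_mktuple.
  have := @shifted_mono _ la (Ordinal (ltnW iK)) (Ordinal iK) (leqnn _).
  by rewrite -!nthE.
have gtn_trans : transitive gtn by move=> x y z /= xy yz; apply: ltn_trans xy.
have eqt : t kappa = t mu :> seq nat.
  apply: (irr_sorted_eq gtn_trans ltnn) => //.
  apply: (uniq_min_size _ _ _).2; rewrite ?size_tuple //.
    exact: (sorted_uniq gtn_trans ltnn).
  move=> _ /mapP[i _ ->]; have [j ->] := sub i.
  by apply/mapP; exists j; rewrite // mem_enum.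
apply: shifted_inj => i; have /val_inj/(congr1 (fun t => tnth t i)) := eqt.
by rewrite !tnth_mktuple.
Qed.

(** For distinct signatures some shifted part of [kappa] is not one of [mu], which gives a zero row;
    for equal ones the matrix is the identity. *)
Lemma det_shifted_delta (F : fieldType) K (kappa mu : signature K) :
  \det (\matrix_(i < K, j < K) (shifted kappa i == shifted mu j)%:R : 'M[F]_K) =
  (kappa == mu)%:R.
Proof.
case: eqVneq => [->|neq].
  transitivity (\det (1%:M : 'M[F]_K)); last by rewrite det1.
  congr (\det _); apply/matrixP => i j; rewrite !mxE.
  have -> : (shifted mu i == shifted mu j) = (i == j) :> bool; last by [].
  apply/eqP/eqP => [eqs|-> //].
  by case: (ltngtP i j) => [||/ord_inj //];
    move=> /(shifted_mono mu); rewrite eqs ltnn.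
have [/existsP[i /forallP Hi]|/existsPn sub] :=
  boolP [exists i, [forall j, shifted kappa i != shifted mu j]]; last first.
  case/eqP: neq; apply: shifted_codom_inj => i.
  by have /forallPn[j /negPn/eqP ?] := sub i; exists j.
rewrite /determinant big1 // => s _; rewrite (bigD1 i) //= mxE (negbTE (Hi _)).
by rewrite mul0r mulr0.
Qed.

(** * Clearing the poles of the g_k *)

Section ClearedPoles.
Variables (F : realFieldType) (a eps : F) (M : nat).
Hypotheses (a_gtN1 : -1 < a) (eps_ge0 : 0 <= eps).

(** What remains of the common denominator, a product of [n] factors in t^2, after the poles of
    phi_m are cancelled. *)
Definition tail_poly n m : {poly F} :=
  newton (fun i => node eps (M.+1 + (m + i))) (n - m).

Definition pole_scale m : F :=
  (-1) ^+ m * (poch M.+1%:R m * poch (M.+1%:R + a) m).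

(* g_k times its common denominator, as a polynomial in t^2. *)
Definition cleared n k : {poly F} :=
  \sum_(m < k.+1) ((jac a eps k)`_m * pole_scale m) *: tail_poly n m.

Lemma pole_scale_neq0 m : pole_scale m != 0.
Proof.
rewrite mulf_neq0 ?signr_eq0 // mulf_neq0 // gt_eqF // poch_gt0 //.
by rewrite -natr1 -addrA ltr_wpDl // -ltrBlDl sub0r.
Qed.

Lemma size_cleared n k : (k <= n)%N -> (size (cleared n k) <= n.+1)%N.
Proof.
move=> kn; apply: (leq_trans (size_sum _ _ _)); apply/bigmax_leqP => m _.
by rewrite (leq_trans (size_scale_leq _ _)) // size_newton ltnS leq_subr.
Qed.

Lemma pole_fun_clear (S : fieldType) (iota : {rmorphism F -> S}) n m (t : S) :
    (m <= n)%N -> (forall i, t ^+ 2 != iota (node eps i)) ->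
  pole_fun a eps iota M.+1 t m *
    \prod_(i < n) (t ^+ 2 - iota (node eps (M.+1 + i))) =
  iota (pole_scale m) *
  \prod_(i < n - m) (t ^+ 2 - iota (node eps (M.+1 + (m + i)))).
Proof.
move=> mn tc; have [k ->] : exists k, n = (m + k)%N.
  by exists (n - m)%N; rewrite subnKC.
rewrite addKn /pole_fun poch_pole big_split_ord /=.
have P0 : \prod_(i < m) (t ^+ 2 - iota (node eps (M.+1 + i))) != 0.
  by apply/prodf_neq0 => i _; rewrite subr_eq0.
rewrite /pole_scale !rmorphM /= !rmorph_poch rmorphD !rmorph_nat.
rewrite !rmorphXn rmorphN1.
by rewrite [((-1) ^+ m * _)^-1]invfM invr_sign; field.
Qed.

Lemma cleared_g_fun (S : fieldType) (iota : {rmorphism F -> S}) n k (t : S) :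
    (k <= n)%N -> (forall i, t ^+ 2 != iota (node eps i)) ->
  (map_poly iota (cleared n k)).[t ^+ 2] =
  g_fun (iota a) (iota eps) M.+1 k t *
  \prod_(i < n) (t ^+ 2 - iota (node eps (M.+1 + i))).
Proof.
move=> kn tc; rewrite (g_fun_umbral a eps iota) (umbralE _ _ (size_poly _ _)).
rewrite mulr_suml rmorph_sum horner_sum; apply: eq_bigr => m _.
rewrite -mulrA pole_fun_clear //; last by rewrite (leq_trans _ kn) // -ltnS.
rewrite mulrA -rmorphM /= map_polyZ hornerZ; congr (_ * _).
rewrite rmorph_prod horner_prod; apply: eq_bigr => i _ /=.
by rewrite rmorphB /= map_polyX map_polyC !hornerE.
Qed.

(** The coefficient matrix of the [cleared n k] is a product of two invertible triangular matrices,
    up to the order of the columns: [A] by the degrees of the [jac], [T] by the degrees [n - m] of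
    the tails. The columns of [V] are the dual functionals. *)
Lemma cleared_dual n : exists V : 'M[F]_n.+1, forall k l : 'I_n.+1,
  \sum_(e < n.+1) (cleared n k)`_e * V e l = (k == l)%:R.
Proof.
pose A : 'M[F]_n.+1 := \matrix_(k, m) ((jac a eps k)`_m * pole_scale m).
(* Columns run through the degrees downwards so that [T] is triangular; [rev_ord] undoes this in
   [V]. *)
pose T : 'M[F]_n.+1 := \matrix_(m, r) (tail_poly n m)`_(n - r).
have detA : \det A != 0.
  rewrite det_trig; last first.
    by apply/is_trig_mxP => k m km; rewrite mxE nth_default ?mul0r // size_jac.
  apply/prodf_neq0 => k _; rewrite mxE mulf_neq0 ?pole_scale_neq0 //.
  by rewrite coef_jac mulf_neq0 ?weight_neq0 // gt_eqF // newton_node_gt0.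
have detT : \det T != 0.
  rewrite -det_tr det_trig; last first.
    apply/is_trig_mxP => r m rm; rewrite !mxE nth_default // size_newton.
    by rewrite ltn_sub2l // (leq_trans rm) // -ltnS.
  apply/prodf_neq0 => m _; rewrite !mxE.
  have := size_newton (fun i => node eps (M.+1 + (m + i))) (n - m).
  rewrite -/(tail_poly n m) => sz.
  have : lead_coef (tail_poly n m) != 0 by rewrite lead_coef_eq0 -size_poly_eq0 sz.
  by rewrite lead_coefE sz.
have AT : A *m T \in unitmx by rewrite unitmxE det_mulmx unitfE mulf_neq0.
exists (\matrix_(e, l) invmx (A *m T) (rev_ord e) l) => k l.
have /matrixP/(_ k l) := mulmxV AT; rewrite !mxE => <-.
rewrite (reindex_inj rev_ord_inj) /=; apply: eq_bigr => r _.
rewrite mxE rev_ordK subSS mxE; congr (_ * _).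
rewrite coef_sum (big_ord_widen n.+1
  (fun m => (((jac a eps k)`_m * pole_scale m) *: tail_poly n m)`_(n - r))) //.
rewrite big_mkcond; apply: eq_bigr => m _; rewrite !mxE coefZ.
by case: ltnP => // km; rewrite nth_default ?mul0r // size_jac.
Qed.

End ClearedPoles.

(** The cleared functions are polynomials in t^2, so a functional on coefficients is carried over by
    halving even exponents. *)
Lemma umbral_comp_X2 (F : fieldType) d (v : nat -> F) (p : {poly F}) :
    (size p <= d.+1)%N ->
  umbral idfun (fun e => if (2 %| e)%N then v (e %/ 2)%N else 0) (p \Po 'X^2) =
  \sum_(e < d.+1) p`_e * v e.
Proof.
move=> pd; rewrite (@umbralE _ _ _ d.+1.*2) /=; last first.
  rewrite (leq_trans (size_comp_poly_leq _ _)) // size_polyXn /= doubleS ltnS.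
  by rewrite muln2 leqW // leq_double -subn1 leq_subLR add1n.
elim: d.+1 => [|d' IHd]; first by rewrite !big_ord0.
rewrite doubleS !big_ord_recr /= IHd -muln2 dvdn_mull // mulnK //.
rewrite coef_comp_poly_Xn // dvdn_mull // mulnK //.
by rewrite dvdn2 /= muln2 odd_double mulr0 addr0.
Qed.

Section LinearIndependence.
Variables (F : realFieldType) (a eps : F) (K M : nat).
Hypotheses (a_gtN1 : -1 < a) (eps_ge0 : 0 <= eps).

Definition g_det (kappa : signature K) : ratfun F K :=
  \det (\matrix_(i < K, j < K)
    g_fun (rat_const K a) (rat_const K eps) M.+1 (shifted kappa i) (rat_var F j)).

Lemma cleared_det n (kappa : signature K) : (forall i, shifted kappa i <= n)%N ->
  tofrac (\det (\matrix_(i < K, j < K)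
    psubst (cleared a eps M n (shifted kappa i) \Po 'X^2) ('X_j : {mpoly F[K]}))) =
  g_det kappa *
  \prod_(j < K) \prod_(i < n)
     (rat_var F j ^+ 2 - rat_const K (node eps (M.+1 + i))).
Proof.
move=> kn; pose D (j : 'I_K) : ratfun F K := \prod_(i < n)
  (rat_var F j ^+ 2 - rat_const K (node eps (M.+1 + i))).
rewrite -[X in _ = _ * X]/(\prod_j D j).
have -> : \prod_j D j = \det (diag_mx (\row_j D j)).
  by rewrite det_diag; apply: eq_bigr => j _; rewrite mxE.
rewrite /g_det -det_mulmx -det_map_mx; congr (\det _); apply/matrixP => i j.
rewrite mul_mx_diag !mxE.
have := @cleared_g_fun _ a eps M (ratfun F K) (@rat_const F K) n _ (rat_var F j) (kn i).
move=> /(_ (fun i => rat_var_sqr_neq _ _)) <-.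
rewrite psubst_comp_poly /psubst map_polyXn hornerXn.
rewrite -horner_map -map_poly_comp rmorphXn.
by [].
Qed.

(** After clearing poles, the functional dual to index [shifted mu j] is applied in each variable
    [j]. By [det_shifted_delta] this annihilates every determinant but that of [mu]. *)
Lemma g_det_free (s : seq (signature K)) (c : signature K -> F) : uniq s ->
  \sum_(kappa <- s) rat_const K (c kappa) * g_det kappa = 0 ->
  forall kappa, kappa \in s -> c kappa = 0.
Proof.
move=> us sum0 mu mus.
(* A bound on all indices in [s], so that one denominator serves every [kappa]. *)
pose n := \max_(kappa <- s) \max_i shifted kappa i.
have bnd kappa i : kappa \in s -> (shifted kappa i <= n)%N.
  move=> ks; rewrite /n (big_rem kappa) //= leq_max.
  by rewrite (leq_bigmax (F := fun i => shifted kappa i)).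
pose X kappa : {mpoly F[K]} := \det (\matrix_(i < K, j < K)
    psubst (cleared a eps M n (shifted kappa i) \Po 'X^2) 'X_j).
have X0 : \sum_(kappa <- s) c kappa *: X kappa = 0.
  apply/eqP; rewrite -tofrac_eq0 rmorph_sum /=; apply/eqP.
  transitivity ((\sum_(kappa <- s) rat_const K (c kappa) * g_det kappa) *
    \prod_(j < K) \prod_(i < n)
     (rat_var F j ^+ 2 - rat_const K (node eps (M.+1 + i)))); last first.
    by rewrite sum0 mul0r.
  rewrite mulr_suml; apply: eq_big_seq => kappa ks.
  rewrite -mulrA -cleared_det; last by move=> i; apply: bnd.
  by rewrite -mul_mpolyC tofracM.
have [V HV] := cleared_dual M a_gtN1 eps_ge0 n.
pose h (j : 'I_K) e := if (2 %| e)%N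
  then V (inord (e %/ 2)) (inord (shifted mu j)) else 0.
have hX kappa : kappa \in s -> mumbral idfun h (X kappa) = (kappa == mu)%:R.
  move=> ks; rewrite mumbral_det -det_shifted_delta.
  congr (\det _); apply/matrixP => i j; rewrite !mxE.
  have kn : (shifted kappa i < n.+1)%N by rewrite ltnS bnd.
  have mn : (shifted mu j < n.+1)%N by rewrite ltnS bnd.
  rewrite (umbral_comp_X2 (fun e => V (inord e) (inord (shifted mu j)))
             (size_cleared a eps M (bnd _ i ks))).
  have := HV (Ordinal kn) (inord (shifted mu j)).
  rewrite -val_eqE /= inordK // => <-.
  by apply: eq_bigr => e _; rewrite inord_val.
have : \sum_(kappa <- s) c kappa * (kappa == mu)%:R = 0.
  transitivity (mumbral idfun h (\sum_(kappa <- s) c kappa *: X kappa)).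
    rewrite raddf_sum; apply: eq_big_seq => kappa ks /=.
    by rewrite mumbralZ hX.
  by rewrite X0 raddf0.
rewrite (bigD1_seq mu) //= eqxx mulr1 big1 ?addr0 // => kappa neq.
by rewrite (negbTE neq) mulr0.
Qed.

Lemma g_det_neq0 (kappa : signature K) : g_det kappa != 0.
Proof.
apply/eqP => g0; have := @g_det_free [:: kappa] (fun=> 1) isT.
rewrite big_seq1 g0 mulr0 => /(_ erefl kappa (mem_head _ _))/eqP.
by rewrite oner_eq0.
Qed.

End LinearIndependence.
(** * Existence of the branching expansion *)

(** A strictly decreasing sequence of naturals dominates the staircase [K - i.+1]; subtracting it
    leaves weakly decreasing parts. *)
Lemma shifted_surj K (g : 'I_K -> nat) :
    (forall i j : 'I_K, (i < j)%N -> (g j < g i)%N) ->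
  exists kappa : signature K, shifted kappa =1 g.
Proof.
move=> g_dec.
have g_ge d : forall i : 'I_K, (K - i.+1 = d)%N -> (d <= g i)%N.
  elim: d => // d IHd i iE.
  have iK : (i.+1 < K)%N by rewrite -subn_gt0 iE.
  have := g_dec i (Ordinal iK) (leqnn _); apply: leq_trans.
  by rewrite ltnS; apply: IHd; rewrite /= subnS iE.
pose t := [tuple (g i - (K - i.+1))%N | i < K].
have t_sorted : sorted geq t.
  apply/(sortedP 0%N) => i; rewrite size_tuple => iK.
  have nthE (o : 'I_K) : nth 0%N t o = (g o - (K - o.+1))%N.
    by rewrite -tnth_nth tnth_mktuple.
  have := g_dec (Ordinal (ltnW iK)) (Ordinal iK) (leqnn _).
  have := g_ge _ (Ordinal (ltnW iK)) erefl.
  have := g_ge _ (Ordinal iK) erefl.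
  rewrite /geq /= -[i.+1]/(val (Ordinal iK)) nthE.
  rewrite -[X in nth _ _ X]/(val (Ordinal (ltnW iK))) nthE /=.
  move: (g _) (g _) => x y; lia.
exists (exist _ t t_sorted) => i.
rewrite /shifted /part tnth_mktuple subnK //.
exact: g_ge erefl.
Qed.

Section Spanning.
Variables (F : realFieldType) (a eps : F) (K : nat).
Hypotheses (a_gtN1 : -1 < a) (eps_ge0 : 0 <= eps).

(** Signatures may repeat in the list, so that adding combinations is concatenation. *)
Definition jac_span (P : {mpoly F[K]}) : Prop :=
  exists s : seq (F * signature K), P = \sum_(x <- s) x.1 *: jac_det a eps x.2.

Lemma jac_span_sum (I : Type) (r : seq I) (P : pred I) (X : I -> {mpoly F[K]}) :
  (forall i, jac_span (X i)) -> jac_span (\sum_(i <- r | P i) X i).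
Proof.
move=> XP; apply: big_ind => //; first by exists [::]; rewrite big_nil.
by move=> _ _ [s ->] [s' ->]; exists (s ++ s'); rewrite big_cat.
Qed.

Lemma jac_spanZ c P : jac_span P -> jac_span (c *: P).
Proof.
move=> [s ->]; exists [seq (c * x.1, x.2) | x <- s].
by rewrite big_map scaler_sumr; apply: eq_bigr => x _; rewrite scalerA.
Qed.

(** A repeated index gives two equal rows; otherwise sorting the indices decreasingly yields the
    determinant of a signature up to sign. *)
Lemma jac_span_det (f : 'I_K -> nat) :
  jac_span (\det (\matrix_(i, j) psubst (jac a eps (f i)) 'X_j)).
Proof.
set B := \matrix_(i, j) _.
have [/injectiveP f_inj|] := boolP (injectiveb f); last first.
  case/injectivePn => i [j ij fij]; exists [::]; rewrite big_nil.
  by apply: (determinant_alternate ij) => k; rewrite !mxE fij.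
have geq_trans : transitive geq by move=> x y z /[swap]; apply: leq_trans.
have geq_total : total geq by move=> x y /=; apply: leq_total.
pose t := [tuple f i | i < K].
have /tuple_permP[s sE] : perm_eq (sort_tuple geq t) t by rewrite perm_sort.
have gE (i : 'I_K) : nth 0%N (sort geq t) i = f (s i).
  by rewrite -[sort geq t]/(tval (sort_tuple geq t)) sE -tnth_nth !tnth_mktuple.
have g_dec (i j : 'I_K) : (i < j)%N -> (f (s j) < f (s i))%N.
  move=> ij; rewrite ltn_neqAle; apply/andP; split.
    by apply: contraTneq ij => /f_inj/perm_inj ->; rewrite ltnn.
  rewrite -!gE; have := sorted_leq_nth geq_trans leqnn 0%N (sort_sorted geq_total t).
  by move=> /(_ i j); rewrite !inE size_sort !size_tuple; apply; rewrite // ltnW.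
have [kappa kappaE] := shifted_surj g_dec.
exists [:: ((-1) ^+ s, kappa)]; rewrite big_seq1 /=.
have -> : jac_det a eps kappa = \det (row_perm s B).
  by congr (\det _); apply/matrixP => i j; rewrite !mxE kappaE.
rewrite row_permE det_mulmx det_perm -mul_mpolyC rmorphXn /= mpolyCN mpolyC1.
by rewrite mulrA -expr2 sqrr_sign mul1r.
Qed.

Lemma jac_basis d (q : {poly F}) : (size q <= d)%N ->
  exists e : 'I_d -> F, q = \sum_(l < d) e l *: jac a eps l.
Proof.
elim: d q => [|d IHd] q qd.
  exists (fun=> 0); rewrite big_ord0; apply/eqP.
  by rewrite -size_poly_eq0 -leqn0.
have lead0 : (jac a eps d)`_d != 0.
  by rewrite coef_jac mulf_neq0 ?weight_neq0 // gt_eqF // newton_node_gt0.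
pose c := q`_d / (jac a eps d)`_d.
have /IHd[e eE] : (size (q - c *: jac a eps d)%R <= d)%N.
  apply/leq_sizeP => k; rewrite leq_eqVlt => /predU1P[<-|dk].
    by rewrite coefB coefZ divfK ?subrr.
  rewrite coefB coefZ !nth_default ?mulr0 ?subr0 // ?size_jac //.
  exact: leq_trans dk.
exists (fun l => if insub (val l) is Some l' then e l' else c).
rewrite big_ord_recr /= insubF ?ltnn //; apply/eqP; rewrite -subr_eq eE; apply/eqP.
by apply: eq_bigr => l _; rewrite valK.
Qed.

Definition perm_vars (s : 'S_K) : K.-tuple {mpoly F[K]} := [tuple 'X_(s i) | i < K].

(** Each power of a variable is expanded in the [jac]; antisymmetrizing a product of one [jac] per
    variable gives a determinant. *)
Lemma jac_span_alternating_monomial (m : 'X_{1..K}) :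
  jac_span (\sum_(s : 'S_K) (-1) ^+ s *: ('X_[m] \mPo perm_vars s)).
Proof.
pose d := (mdeg m).+1.
have /boolp.choice[e eE] (j : 'I_K) : exists e : 'I_d -> F,
    'X^(m j) = \sum_(l < d) e l *: jac a eps l.
  by apply: jac_basis; rewrite size_polyXn ltnS mdegE (bigD1 j) //= leq_addr.
have mE : 'X_[m] = \sum_(f : {ffun 'I_K -> 'I_d}) (\prod_j e j (f j)) *:
    \prod_j psubst (jac a eps (f j)) ('X_j : {mpoly F[K]}).
  rewrite mpolyXE_id.
  transitivity (\prod_j \sum_(l < d) e j l *: psubst (jac a eps l) ('X_j : {mpoly F[K]})).
    apply: eq_bigr => j _; transitivity (psubst 'X^(m j) ('X_j : {mpoly F[K]})).
      by rewrite /psubst map_polyXn hornerXn.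
    rewrite eE /psubst rmorph_sum horner_sum; apply: eq_bigr => l _ /=.
    exact: psubstZ.
  by rewrite bigA_distr_bigA; apply: eq_bigr => f _; rewrite scaler_prod.
have -> : \sum_(s : 'S_K) (-1) ^+ s *: ('X_[m] \mPo perm_vars s) =
    \sum_(f : {ffun 'I_K -> 'I_d}) (\prod_j e j (f j)) *:
      \det (\matrix_(i, j) psubst (jac a eps (f i)) ('X_j : {mpoly F[K]})).
  transitivity (\sum_(s : 'S_K) \sum_(f : {ffun 'I_K -> 'I_d})
    (\prod_j e j (f j)) *: ((-1) ^+ s *
      \prod_j psubst (jac a eps (f j)) ('X_(s j) : {mpoly F[K]}))).
    apply: eq_bigr => s _; rewrite mE rmorph_sum scaler_sumr; apply: eq_bigr => f _ /=.
    rewrite comp_mpolyZ scalerA mulrC -scalerA; congr (_ *: _).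
    rewrite -mul_mpolyC rmorphXn /= mpolyCN mpolyC1 rmorph_prod; congr (_ * _).
    by apply: eq_bigr => j _; rewrite /= psubst_comp comp_mpolyXt tnth_mktuple.
  rewrite exchange_big; apply: eq_bigr => f _ /=.
  rewrite -scaler_sumr; congr (_ *: _); apply: eq_bigr => s _; congr (_ * _).
  by apply: eq_bigr => j _; rewrite mxE.
by apply: jac_span_sum => f; apply/jac_spanZ/jac_span_det.
Qed.

(** An alternating polynomial is its antisymmetrization divided by K!, which is invertible in
    characteristic 0. *)
Lemma jac_span_alternating (P : {mpoly F[K]}) :
  (forall s : 'S_K, P \mPo perm_vars s = (-1) ^+ s *: P) -> jac_span P.
Proof.
move=> altP.
have -> : P = (K`!%:R)^-1 *: \sum_(s : 'S_K) (-1) ^+ s *: (P \mPo perm_vars s).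
  under eq_bigr do rewrite altP scalerA -expr2 sqrr_sign scale1r.
  rewrite sumr_const card_Sn -scaler_nat scalerA mulVf ?scale1r //.
  by rewrite pnatr_eq0 -lt0n fact_gt0.
apply: jac_spanZ.
have -> : \sum_(s : 'S_K) (-1) ^+ s *: (P \mPo perm_vars s) =
   \sum_(m <- msupp P) P@_m *:
     \sum_(s : 'S_K) (-1) ^+ s *: ('X_[m] \mPo perm_vars s).
  under [RHS]eq_bigr do rewrite scaler_sumr.
  rewrite exchange_big; apply: eq_bigr => s _ /=.
  rewrite {1}[P]mpolyE rmorph_sum scaler_sumr; apply: eq_bigr => m _ /=.
  by rewrite comp_mpolyZ !scalerA mulrC.
by apply: jac_span_sum => m; apply/jac_spanZ/jac_span_alternating_monomial.
Qed.

(** Permuting the variables permutes the first [K] columns, so this determinant is alternating. *)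
Lemma jac_span_det_row M (q : 'I_(K + M) -> {poly F}) (C : 'M[F]_(K + M, M)) :
  jac_span (\det (row_mx (\matrix_(i, j) psubst (q i) 'X_j)
                         (map_mx (@mpolyC K F) C))).
Proof.
apply: jac_span_alternating => s.
set B := \matrix_(i, j) _; set D := map_mx _ _.
have := det_map_mx (comp_mpoly (perm_vars s)) (row_mx B D) => /= <-.
have -> : map_mx (comp_mpoly (perm_vars s)) (row_mx B D) =
    row_mx B D *m block_mx (perm_mx s^-1) 0 0 1%:M.
  rewrite mul_row_block !mulmx0 mulmx1 addr0 add0r -col_permE map_row_mx.
  congr row_mx; apply/matrixP => i j; rewrite !mxE /=.
    by rewrite psubst_comp comp_mpolyXt tnth_mktuple.
  by rewrite comp_mpolyC.
rewrite det_mulmx det_ublock det1 mulr1 det_perm odd_permV mulrC.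
by rewrite -mul_mpolyC rmorphXn /= mpolyCN mpolyC1.
Qed.

End Spanning.
Local Open Scope classical_set_scope.

Lemma finitely_supported_seq (F : fieldType) K (c : signature K -> F) :
    finitely_supported c ->
  exists s : seq (signature K), uniq s /\ forall kappa, kappa \notin s -> c kappa = 0.
Proof.
move=> /finite_seqP[s sE]; exists (undup s); rewrite undup_uniq; split=> // kappa.
rewrite mem_undup; apply: contraNeq => ck.
by have : [set` s] kappa by rewrite -sE.
Qed.

Lemma fsum_seq (V : zmodType) K (X : signature K -> V) (s : seq (signature K)) :
    uniq s -> (forall kappa, kappa \notin s -> X kappa = 0) ->
  \sum_(kappa \in [set: signature K]) X kappa = \sum_(kappa <- s) X kappa.
Proof.
move=> us X0; rewrite (@fsbigE _ _ _ _ setT s) // => [|kappa _]; last exact: X0.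
by apply: eq_bigl => kappa; rewrite in_setT.
Qed.

Section Branching.
Variables (F : realFieldType) (a b eps : F).
Hypotheses (a_gtN1 : -1 < a) (eps_ge0 : 0 <= eps) (epsE : a + b + 1 = eps *+ 2).
Variables (K M : nat) (nu : signature (K + M)).

Lemma one_minus2_inj : injective (comp_mpoly (one_minus2 F K)).
Proof.
pose t := [tuple 2^-1 *: (1 - 'X_j) : {mpoly F[K]} | j < K].
suff inv : cancel (comp_mpoly (one_minus2 F K)) (comp_mpoly t) by apply: can_inj inv.
move=> r; rewrite comp_mpolyA -[RHS]comp_mpoly_id; congr (_ \mPo _).
apply: eq_from_tnth => j; rewrite !tnth_mktuple comp_mpolyB comp_mpoly1 comp_mpolyMn.
rewrite comp_mpolyXt tnth_mktuple -scaler_nat scalerA mulfV ?pnatr_eq0 //.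
by rewrite scale1r opprB addrC addrNK.
Qed.

Lemma branching_exists : exists c : signature K -> F, branching a b nu c.
Proof.
have [s sE] := jac_span_det_row a_gtN1 eps_ge0
  (fun i => drop_poly M (jac a eps (shifted nu i)))
  (\matrix_(i < K + M, j < M) (jac a eps (shifted nu i))`_(M - j.+1)).
pose v := (jac_value a eps nu)^-1.
(* Terms with the same signature are gathered; the factor [jac_value a eps kappa] undoes the
   normalization of [jacobi_norm]. *)
pose c kappa := \sum_(x <- s | x.2 == kappa) v * x.1 * jac_value a eps kappa.
pose r := undup [seq x.2 | x <- s].
have c0 kappa : kappa \notin r -> c kappa = 0.
  rewrite mem_undup => ks; rewrite /c big_seq_cond big_pred0 // => x.
  by apply/negP => /andP[xs /eqP xk]; case/mapP: ks; exists x.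
exists c; split.
  apply: (@sub_finite_set _ _ [set` r]); last exact: finite_seq.
  by move=> kappa /=; apply: contraNT => /c0 ->.
rewrite (@fsum_seq _ _ _ r) ?undup_uniq // => [|kappa /c0 ->]; last by rewrite scale0r.
apply: one_minus2_inj; apply: (mulIf (vandermonde_prod_neq0 F K)).
rewrite (jacobi_norm_pad a_gtN1 eps_ge0 epsE) {}sE rmorph_sum mulr_suml scaler_sumr /=.
transitivity (\sum_(kappa <- r) \sum_(x <- s | x.2 == kappa)
    (v * x.1) *: jac_det a eps kappa).
  rewrite (exchange_big_dep xpredT) //=; apply: eq_big_seq => x xs.
  have xr : x.2 \in r by rewrite mem_undup; apply: map_f.
  rewrite -big_filter (perm_big [:: x.2]) ?big_seq1 ?scalerA //.
  apply: uniq_perm; rewrite ?filter_uniq ?undup_uniq // => k.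
  rewrite mem_filter inE; case: (eqVneq x.2 k) => [<-|neq]; first by rewrite ?xr ?eqxx.
  by rewrite ?andbF /= ?(eq_sym k) ?(negbTE neq).
apply: eq_bigr => kappa _; rewrite comp_mpolyZ -scalerAl.
rewrite (jacobi_norm_comp a_gtN1 eps_ge0 epsE) scalerA /c.
rewrite -mulr_suml mulfK ?jac_value_neq0 //.
by rewrite scaler_suml.
Qed.

(** Existence of an expansion excludes the default value in [Lambda]. *)
Lemma Lambda_branching : branching a b nu (Lambda a b nu : signature K -> F).
Proof.
have [c cE] := branching_exists.
exact: (@xgetI _ (fun=> 0) [set c | branching a b nu c] c).
Qed.

End Branching.

(** * The identity of rational functions and its uniqueness *)

Section RationalIdentity.
Variables (F : realFieldType) (a b eps : F).
Hypotheses (a_gtN1 : -1 < a) (eps_ge0 : 0 <= eps) (epsE : a + b + 1 = eps *+ 2).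
Variables (K M : nat) (nu : signature (K + M)).

Lemma d_prodE (kappa : signature K) :
  d_prod kappa eps = jac_value a eps kappa / jac_value a eps (signature0 K).
Proof.
rewrite /jac_value invfM mulrACA mulfV ?newton_coef_det_neq0 // mul1r.
rewrite -prodf_div; apply: eq_bigr => i _; rewrite -prodf_div.
by apply: eq_bigr => j _; rewrite !shifted0.
Qed.

Lemma d_prod_neq0 (kappa : signature K) : d_prod kappa eps != 0.
Proof. by rewrite d_prodE mulf_neq0 ?invr_eq0 ?jac_value_neq0. Qed.

Lemma G_funE (kappa : signature K) :
  G_fun (rat_const K a) (rat_const K eps) M.+1 kappa (@rat_var F K) =
  g_det a eps M kappa / g_det a eps M (signature0 K).
Proof.
congr (_ / _); congr (\det _); apply/matrixP => i j.
by rewrite !mxE shifted0.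
Qed.

Lemma ratfun_identity_seq (c : signature K -> F) (s : seq (signature K)) :
    uniq s -> (forall kappa, kappa \notin s -> c kappa = 0) ->
  ratfun_identity a eps M.+1 nu c <->
  \prod_(j < K) F_prod (rat_var F j) nu (rat_const K eps) =
  \sum_(kappa <- s) rat_const K (c kappa / d_prod kappa eps) *
    (g_det a eps M kappa / g_det a eps M (signature0 K)).
Proof.
move=> us c0.
have sumE : \sum_(kappa \in [set: signature K])
    rat_const K (c kappa / d_prod kappa eps) *
      G_fun (rat_const K a) (rat_const K eps) M.+1 kappa (@rat_var F K) =
  \sum_(kappa <- s) rat_const K (c kappa / d_prod kappa eps) *
    (g_det a eps M kappa / g_det a eps M (signature0 K)).
  apply: (etrans (fsum_seq us _)) => [kappa ks|].
    have -> : c kappa / d_prod kappa eps = 0 by rewrite c0 // mul0r.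
    exact: etrans (congr1 ( *%R^~ _) (rmorph0 (@rat_const F K))) (mul0r _).
  by apply: eq_bigr => kappa _; apply: (congr1 ( *%R _)); apply: G_funE.
by split=> h; [apply: (etrans h sumE) | apply: (etrans h (esym sumE))].
Qed.

(** Used with [v] and [w] the [jac_value] of [kappa] and of the zero signature, whose ratio is
    [d_prod] by [d_prodE]. *)
Lemma rescale_quotient (S : fieldType) (iota : {rmorphism F -> S})
    (x v w : F) (p q : S) : v != 0 -> w != 0 -> q != 0 ->
  iota x * (iota v^-1 * p) = iota (x / (v / w)) * (p / q) * (iota w^-1 * q).
Proof.
move=> v0 w0 q0; rewrite !fmorph_div !fmorphV; field.
by rewrite q0 !fmorph_eq0 v0 w0.
Qed.

Lemma branching_ratfun_identity (c : signature K -> F) :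
  branching a b nu c -> ratfun_identity a eps M.+1 nu c.
Proof.
move=> [/finitely_supported_seq[s [us c0]]].
rewrite (@fsum_seq _ _ _ s) // => [|kappa /c0 ->]; last by rewrite scale0r.
move=> nuE; apply/(ratfun_identity_seq us c0).
pose g := @g_det F a eps K M; pose iota : {rmorphism F -> ratfun F K} := @rat_const F K.
have v0 kappa : jac_value a eps kappa != 0 by apply: jac_value_neq0.
have g0 : g (signature0 K) != 0 by apply: g_det_neq0.
(* The Vandermonde product is the case of the zero signature, so its image is the denominator of
   [G_fun] up to a nonzero constant. *)
have TV : transform a eps M (vandermonde_prod F K) =
    iota (jac_value a eps (signature0 K))^-1 * g (signature0 K).
  have P0 : (jacobi_norm a b (signature0 K) \mPo one_minus2 F K) *
      vandermonde_prod F K = vandermonde_prod F K.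
    by rewrite (jacobi_norm0 a_gtN1 eps_ge0 epsE) mul1r.
  exact: (etrans (congr1 (transform a eps M) (esym P0))
    (transform_jacobi a_gtN1 eps_ge0 epsE M (signature0 K))).
have TV0 : transform a eps M (vandermonde_prod F K) != 0.
  by rewrite TV; apply: mulf_neq0; rewrite ?fmorph_eq0 ?invr_neq0.
apply: (mulIf TV0).
apply: (etrans (esym (transform_F_prod a_gtN1 eps_ge0 epsE nu))).
have -> : ((jacobi_norm a b nu \mPo pad_ones F (K + M) K) \mPo one_minus2 F K) *
    vandermonde_prod F K = \sum_(kappa <- s) c kappa *:
    ((jacobi_norm a b kappa \mPo one_minus2 F K) * vandermonde_prod F K).
  rewrite nuE rmorph_sum mulr_suml; apply: eq_bigr => kappa _ /=.
  by rewrite comp_mpolyZ -scalerAl.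
rewrite /transform [LHS]raddf_sum mulr_suml; apply: eq_bigr => kappa _ /=.
rewrite mumbralZ -/(transform a eps M _).
apply: (etrans (congr1 ( *%R _) (transform_jacobi a_gtN1 eps_ge0 epsE M kappa))).
rewrite -/(transform a eps M _) TV d_prodE -/(g kappa).
have rq := rescale_quotient iota (c kappa) (g kappa) (v0 _ kappa) (v0 _ (signature0 K)) g0.
refine rq.
Qed.

(** Both sums are taken over the union of the supports and subtracted; once the common denominator
    of the G is removed, [g_det_free] applies. *)
Lemma ratfun_identity_unique (c c' : signature K -> F) :
    finitely_supported c -> finitely_supported c' ->
    ratfun_identity a eps M.+1 nu c -> ratfun_identity a eps M.+1 nu c' ->
  c =1 c'.
Proof.
move=> /finitely_supported_seq[s [us c0]] /finitely_supported_seq[s' [us' c0']].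
pose r := undup (s ++ s').
have ur : uniq r by apply: undup_uniq.
have r0 kappa : kappa \notin r -> c kappa = 0.
  by rewrite mem_undup mem_cat negb_or => /andP[/c0].
have r0' kappa : kappa \notin r -> c' kappa = 0.
  by rewrite mem_undup mem_cat negb_or => /andP[_ /c0'].
move=> /(ratfun_identity_seq ur r0) cE /(ratfun_identity_seq ur r0') c'E kappa.
have eqcc' := etrans (esym cE) c'E.
have [kr|kr] := boolP (kappa \in r); last by rewrite r0 // r0'.
have g0 : g_det a eps M (signature0 K) != 0 by apply: g_det_neq0.
have := @g_det_free _ a eps K M a_gtN1 eps_ge0 r
  (fun mu => c mu / d_prod mu eps - c' mu / d_prod mu eps) ur _ kappa kr.
rewrite -mulrBl => free; apply/eqP; rewrite -subr_eq0.
rewrite -(mulIr_eq0 _ (mulIf (invr_neq0 (d_prod_neq0 kappa)))); apply/eqP/free.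
have sumB (S : fieldType) (x y p : signature K -> S) (q : S) : q != 0 ->
    \sum_(mu <- r) x mu * (p mu / q) = \sum_(mu <- r) y mu * (p mu / q) ->
    \sum_(mu <- r) (x mu - y mu) * p mu = 0.
  move=> q0 /eqP; rewrite -subr_eq0 -sumrB => /eqP eqxy.
  apply: (mulIf (invr_neq0 q0)); rewrite mul0r mulr_suml -[RHS]eqxy.
  by apply: eq_bigr => mu _; rewrite -mulrA mulrBl.
apply: (etrans _ (sumB _ _ _ _ _ g0 eqcc')); apply: eq_bigr => mu _.
apply: (congr1 (fun z => z * g_det a eps M mu)).
exact: (rmorphB (@rat_const F K : {rmorphism F -> ratfun F K})).
Qed.

End RationalIdentity.

Theorem theoremA (R : realType) (a b : R) (N K : nat) (nu : signature N) :
  -1 < a -> -1 < b -> -1 <= a + b -> (1 <= K)%N -> (K < N)%N ->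
  let eps : R := (a + b + 1) / 2 in
  let L : nat := (N - K + 1)%N in
  let Lam : signature K -> R := Lambda a b nu in
  [/\ (* Lambda is well defined: it satisfies its defining expansion *)
      branching a b nu Lam,
      finitely_supported Lam,
      ratfun_identity a eps L nu Lam
    & forall c : signature K -> R, finitely_supported c ->
        ratfun_identity a eps L nu c -> forall kappa, c kappa = Lam kappa].
Proof.
move=> a_gtN1 _ ab_geN1 _ KN eps L Lam.
have eps_ge0 : 0 <= eps by rewrite divr_ge0 // -lerBlDr sub0r.
have epsE : a + b + 1 = eps *+ 2 by rewrite -mulr_natr divfK ?pnatr_eq0.
(* With N = K + M, the parameter L = N - K + 1 is [M.+1], the form required by the lemmas above. *)
have [M NE] : exists M, N = (K + M)%N by exists (N - K)%N; rewrite subnKC // ltnW.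
rewrite {}/Lam {}/L; clearbody eps; subst N; rewrite addKn addn1.
have Lb := Lambda_branching a_gtN1 eps_ge0 epsE nu.
have Lid := branching_ratfun_identity a_gtN1 eps_ge0 epsE Lb.
split=> //; first exact: Lb.1.
move=> c c_fin c_id.
exact: (ratfun_identity_unique a_gtN1 eps_ge0 c_fin Lb.1 c_id Lid).
Qed.
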